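(* Let $n\geq2$ and let $\mathbb{S}^n\subset\mathbb{R}^{n+1}$ be the unit sphere with its standard round metric. Let $f$ be a smooth non-constant real function on $\mathbb{S}^n$. For each integer $k\geq1$ let $h_k$ be the restriction to $\mathbb{S}^n$ of the function $(x_1,\dots,x_{n+1})\mapsto\mathrm{Re}\,(x_1+ix_2)^k$, and set $$\phi_k=e^{kf}h_k,\qquad V_k=2k\nabla f,\qquad W_k=k\Delta f-k^2|\nabla f|^2-k(k+n-1).$$ Then $\phi_k$ vanishes at order $k$ at the north pole $(0,\dots,0,1)$, one has $$\Delta\phi_k=\langle V_k,\nabla\phi_k\rangle+W_k\phi_k\quad\text{on }\mathbb{S}^n,$$ and there is a constant $C>0$ depending only on $(f,n)$ such that for all $k\geq1$ $$C^{-1}k\leq\|V_k\|_{\mathcal{C}^1}\leq Ck,\qquad C^{-1}k^2\leq\|W_k\|_{\mathcal{C}^1}\leq Ck^2.$$ Therefore the uniform upper bound $C(1+\|W\|_{\mathcal{C}^1}^{1/2}+\|V\|_{\mathcal{C}^1})$ on the vanishing order of solutions to $\Delta u+V\cdot\nabla u+Wu=0$ is sharp with respect to the power of the norms of the potentials $V$ and $W$: in this bound one cannot replace the exponents $1$ on $\|V\|_{\mathcal{C}^1}$ and $\frac12$ on $\|W\|_{\mathcal{C}^1}$ by lower ones.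
   Context: $\Delta$ is the Laplace operator (convention $\Delta=\mathrm{div}\,\nabla$, so that $-\Delta h_k=k(k+n-1)h_k$ on $\mathbb{S}^n$), and $V\cdot\nabla u=\langle V,\nabla u\rangle$ is the Riemannian inner product. The norms are $\|W\|_{\mathcal{C}^1}=\|W\|_\infty+\|\nabla W\|_\infty$ and, likewise, $\|V\|_{\mathcal{C}^1}$ is the $\mathcal{C}^1$ norm of the vector field $V$. The vanishing order at $x_0$ of an $L^2$ function $u$ on an $n$-dimensional Riemannian manifold $(M,g)$ is $$\inf\left\{d>0:\ \limsup_{r\to0}\frac{1}{r^{d}}\left(\frac{1}{r^n}\int_{B_r(x_0)}|u|^2\,dv_g\right)^{1/2}>0\right\},$$ where $B_r(x_0)$ is the geodesic ball of radius $r$ centered at $x_0$. The upper bound whose sharpness is asserted is the following: on a smooth, compact, connected, $n$-dimensional Riemannian manifold $(M,g)$, for every $\mathcal{C}^1$ function $W$ and every $\mathcal{C}^1$ vector field $V$ on $M$, the vanishing order of every non-trivial $H^1$ solution of $\Delta u+V\cdot\nabla u+Wu=0$ is everywhere less than $C(1+\|W\|_{\mathcal{C}^1}^{1/2}+\|V\|_{\mathcal{C}^1})$, where $C>0$ depends only on $(M,g)$. *)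

(* Defs.v *)
From HB Require Import structures.
From mathcomp Require Import all_boot all_order all_algebra.
From mathcomp Require Import complex.
From mathcomp Require Import all_classical all_reals all_analysis.
From mathcomp Require Import measurable_realfun.

Set Implicit Arguments.
Unset Strict Implicit.
Unset Printing Implicit Defensive.

Import Order.TTheory GRing.Theory Num.Theory.
Import numFieldNormedType.Exports.

Local Open Scope classical_set_scope.
Local Open Scope ring_scope.

(* Lebesgue measure on R^m, by induction on m: R^(m+1) = R * R^m. *)
Section LebesgueTuple.
Context {R : realType}.
Local Notation mR := (measurableTypeR R).

Definition cons_tuple m (p : mR * m.-tuple mR) : m.+1.-tuple mR :=
  [tuple of p.1 :: p.2].

Definition uncons_tuple m (t : m.+1.-tuple mR) : mR * m.-tuple mR :=
  (thead t, [tuple of behead t]).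

Lemma measurable_cons_tuple m : measurable_fun [set: _] (@cons_tuple m).
Proof. exact: measurable_cons. Qed.

Lemma measurable_uncons_tuple m : measurable_fun [set: _] (@uncons_tuple m).
Proof.
apply/measurable_fun_pairP; split; last exact: measurable_behead.
exact: measurable_tnth.
Qed.

Lemma cons_tupleK m : cancel (@cons_tuple m) (@uncons_tuple m).
Proof. by case=> x t; congr pair; apply/val_inj. Qed.

Section step.
Variables (m : nat) (mu : {sigma_finite_measure set (m.-tuple mR) -> \bar R}).

Definition lebesgue_step : set (m.+1.-tuple mR) -> \bar R :=
  pushforward ((@lebesgue_measure R) \x mu)%E (@cons_tuple m).

HB.instance Definition _ := Measure.copy lebesgue_step
  (measure_function_pushforward__canonical__measure_function_Measure
    ((@lebesgue_measure R) \x mu)%E (@measurable_cons_tuple m)).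

Let lebesgue_step_sigma_finite : sigma_finite setT lebesgue_step.
Proof.
have /sigma_finiteP[A [TA ndA Aoo]] := sigma_finiteT (@lebesgue_measure R).
have /sigma_finiteP[B [TB ndB Boo]] := sigma_finiteT mu.
have [F TF Foo] : sigma_finite setT ((@lebesgue_measure R) \x mu)%E.
  exists (fun k => A k `*` B k) => [|k].
    rewrite -setXTT TA TB predeqE => -[x y]; split.
      move=> [/= [i _ Aix] [j _ Bjy]]; exists (maxn i j) => //; split.
      - by move: x Aix; exact/subsetPset/ndA/leq_maxl.
      - by move: y Bjy; exact/subsetPset/ndB/leq_maxr.
    by move=> [i _ []/= ? ?]; split; exists i.
  have [? ?] := Aoo k; have [? ?] := Boo k.
  split; first exact: measurableX.
  by rewrite product_measure1E// lte_mul_pinfty// ge0_fin_numE.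
exists (fun i => @uncons_tuple m @^-1` F i).
  by rewrite -preimage_bigcup -TF preimage_setT.
move=> i; have [mF Fi] := Foo i; split.
  by rewrite -[X in measurable X]setTI; exact: measurable_uncons_tuple.
rewrite /lebesgue_step /pushforward -comp_preimage.
rewrite (_ : _ @^-1` _ = F i)//.
by apply/seteqP; split => p /=; rewrite cons_tupleK.
Qed.

HB.instance Definition _ := Measure_isSigmaFinite.Build _ _ _ lebesgue_step
  lebesgue_step_sigma_finite.

End step.

Fixpoint lebesgue_tuple m : {sigma_finite_measure set (m.-tuple mR) -> \bar R} :=
  match m with
  | 0 => dirac [tuple]
  | m'.+1 => lebesgue_step (lebesgue_tuple m')
  end.

End LebesgueTuple.

Definition tuple_of_row {R : realType} m (x : 'rV[R]_m) :
    m.-tuple (measurableTypeR R) := [tuple x 0 i | i < m].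

Definition row_of_tuple {R : realType} m (t : m.-tuple (measurableTypeR R)) :
    'rV[R]_m := \row_i tnth t i.

(* Euclidean inner product of row vectors, Hilbert-Schmidt product of matrices;
   the norm `|_| of 'M[R]_(p, q) is the maximum norm. *)
Definition dot {R : realType} p q (A B : 'M[R]_(p, q)) : R :=
  \sum_i \sum_j A i j * B i j.

Definition enorm {R : realType} p q (A : 'M[R]_(p, q)) : R :=
  Num.sqrt (dot A A).

Lemma dotZ {R : realType} p q (c : R) (A : 'M[R]_(p, q)) :
  dot (c *: A) (c *: A) = c ^+ 2 * dot A A.
Proof.
rewrite /dot mulr_sumr; apply: eq_bigr => i _.
rewrite mulr_sumr; apply: eq_bigr => j _.
by rewrite !mxE mulrACA expr2.
Qed.

Lemma dot_ge0 {R : realType} p q (A : 'M[R]_(p, q)) : 0 <= dot A A.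
Proof. by rewrite /dot; do 2 apply: sumr_ge0 => ? _; rewrite -expr2 sqr_ge0. Qed.

Lemma measurable_dot_row {R : realType} m : measurable_fun setT
  (fun t : m.-tuple (measurableTypeR R) => dot (row_of_tuple t) (row_of_tuple t)).
Proof.
under eq_fun do rewrite /dot big_ord1.
apply: measurable_sum => i; under eq_fun do rewrite mxE.
by apply: measurable_funM; exact: measurable_tnth.
Qed.

Section Sphere.
Context {R : realType} {n : nat}.
Local Notation mR := (measurableTypeR R).

(* The unit sphere S^n of R^(n+1). *)
Record sphere := Sphere {
  sphere_val :> 'rV[R]_n.+1 ;
  _ : dot sphere_val sphere_val == 1 }.

HB.instance Definition _ := [isSub for sphere_val].
HB.instance Definition _ := [Choice of sphere by <:].

Lemma dot_north : dot (delta_mx 0 ord_max : 'rV[R]_n.+1) (delta_mx 0 ord_max) == 1.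
Proof.
rewrite /dot big_ord1 (bigD1 ord_max)//= mxE !eqxx mulr1 big1 ?addr0// => i iN.
by rewrite mxE (negPf iN) andbF mulr0.
Qed.

Definition north : sphere := Sphere dot_north.

HB.instance Definition _ := isPointed.Build sphere north.

Definition sphere_coords (x : sphere) : n.+1.-tuple mR := tuple_of_row x.

(* S^n carries the trace of the Borel sigma-algebra of R^(n+1). *)
HB.instance Definition _ :=
  Measurable.copy sphere (g_sigma_algebra_preimageType sphere_coords).

(* Radial projection R^(n+1) \ {0} -> S^n. *)
Definition radial (x : 'rV[R]_n.+1) : sphere :=
  insubd north ((enorm x)^-1 *: x).

Definition radial_tuple (t : n.+1.-tuple mR) : sphere := radial (row_of_tuple t).

End Sphere.
Arguments sphere R n : clear implicits.
Arguments north {R n}.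

Section Volume.
Context {R : realType} {n : nat}.
Local Notation mR := (measurableTypeR R).

Lemma val_radial (x : 'rV[R]_n.+1) :
  radial x = (if dot x x == 0 then north : 'rV_ _ else (enorm x)^-1 *: x) :> 'rV_ _.
Proof.
rewrite /radial val_insubd dotZ exprVn sqr_sqrtr ?dot_ge0//.
case: ifPn => [|/negPf]; have [->|x0] := eqVneq (dot x x) 0 => //.
- by rewrite mulr0 eq_sym oner_eq0.
- by rewrite mulVf// eqxx.
Qed.

Lemma measurable_radial_tuple : measurable_fun setT (@radial_tuple R n).
Proof.
have mc : measurable_fun setT (@sphere_coords R n \o @radial_tuple R n).
  apply/measurable_fun_tnthP => i.
  rewrite (_ : _ \o _ = (fun t => if dot (row_of_tuple t) (row_of_tuple t) == 0
     then (north : 'rV[R]_n.+1) 0 i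
     else (dot (row_of_tuple t) (row_of_tuple t) `^ (- 2^-1)) * tnth t i)).
    apply: measurable_fun_ifT.
    - apply: measurable_fun_eqr => //; exact: measurable_dot_row.
    - exact: measurable_cst.
    - apply: measurable_funM; last exact: measurable_tnth.
      apply: (@measurableT_comp _ _ _ _ _ _ (fun y : R => y `^ (- 2^-1))).
        exact: measurable_powR.
      exact: measurable_dot_row.
  apply/funext => t; rewrite /= tnth_mktuple val_radial.
  by case: ifP => // _; rewrite !mxE powRN powR12_sqrt ?dot_ge0.
move=> _ Y [B mB <-]; rewrite setTI -comp_preimage setTI.
by rewrite -[X in measurable X]setTI; exact: mc.
Qed.

Definition punctured_ball : set (n.+1.-tuple mR) :=
  [set t | 0 < enorm (row_of_tuple t) <= 1].

Lemma measurable_punctured_ball : measurable punctured_ball.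
Proof.
rewrite (_ : punctured_ball = [set t | 0 < dot (row_of_tuple t) (row_of_tuple t)]
   `&` [set t | dot (row_of_tuple t) (row_of_tuple t) <= 1]).
  apply: measurableI.
  - have := @measurable_fun_ltr _ _ R setT (cst 0) _ (@measurable_cst _ _ _ _ _ _)
      (@measurable_dot_row R n.+1).
    by move=> /(_ measurableT [set true] I); rewrite setTI.
  - have := @measurable_fun_ler _ _ R setT _ (cst 1) (@measurable_dot_row R n.+1)
      (@measurable_cst _ _ _ _ _ _).
    by move=> /(_ measurableT [set true] I); rewrite setTI.
apply/seteqP; split => t /=; rewrite /punctured_ball/= /enorm sqrtr_gt0.
- case/andP=> -> h; split => //; rewrite -(sqr_sqrtr (dot_ge0 _)).
  by rewrite expr_le1 ?sqrtr_ge0.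
- by case=> -> h /=; rewrite -sqrtr1 ler_sqrt.
Qed.

(* Riemannian volume of the round sphere as cone measure:
   vol A = (n + 1) * Leb {x | 0 < |x| <= 1 /\ x / |x| \in A}. *)
Definition sphere_vol : set (sphere R n) -> \bar R :=
  pushforward
    (mscale (n.+1%:R%:nng : {nonneg R})
       (mrestr (lebesgue_tuple n.+1) measurable_punctured_ball))
    (@radial_tuple R n).

HB.instance Definition _ := Measure.copy sphere_vol
  (measure_function_pushforward__canonical__measure_function_Measure
    (mscale (n.+1%:R%:nng : {nonneg R})
       (mrestr (lebesgue_tuple n.+1) measurable_punctured_ball))
    measurable_radial_tuple).

End Volume.
Arguments sphere_vol R n : clear implicits.

Section Regularity.
Context {R : realType} {n : nat}.

Fixpoint Ck (k : nat) (E : normedModType R) (F : 'rV[R]_n.+1 -> E) : Prop :=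
  match k with
  | 0 => forall x, x != 0 -> {for x, continuous F}
  | k'.+1 => (forall x, x != 0 -> differentiable F x) /\
             (forall v, Ck k' ('D_v F))
  end.

(* Extension of a function on S^n to R^(n+1) \ {0}, homogeneous of degree 0.
   A function on S^n is C^k iff its extension is C^k, and, the radial derivative
   of the extension being 0, the differential of the extension at a point of S^n
   is the differential on the tangent space, extended by 0 to the normal line. *)
Definition homext (T : Type) (f : sphere R n -> T) : 'rV[R]_n.+1 -> T :=
  f \o radial.

Definition sphere_Ck (k : nat) (E : normedModType R) (f : sphere R n -> E) :=
  Ck k (homext f).

Definition smooth (E : normedModType R) (f : sphere R n -> E) :=
  forall k, sphere_Ck k f.

End Regularity.

Section Geometry.
Context {R : realType} {n : nat}.
Implicit Types (f u W : sphere R n -> R) (V : sphere R n -> 'rV[R]_n.+1).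

(* Vector fields on S^n are represented by maps into R^(n+1). *)
Definition tangent V := forall x, dot (V x) x = 0.

Definition grad f (x : sphere R n) : 'rV[R]_n.+1 :=
  \row_i 'D_(delta_mx 0 i) (homext f) x.

(* Covariant derivative (v |-> nabla_v V) as a matrix acting on row vectors on
   the right: the Levi-Civita connection of S^n is the ambient derivative
   followed by the orthogonal projection 1 - x^T x onto the tangent space. The
   normal vector x is sent to 0, so that traces and Hilbert-Schmidt norms are
   those of the endomorphism of the tangent space. *)
Definition cov V (x : sphere R n) : 'M[R]_n.+1 :=
  'J (homext V) x *m (1%:M - (x : 'rV[R]_n.+1)^T *m (x : 'rV[R]_n.+1)).

Definition divergence V (x : sphere R n) : R := \tr (cov V x).

Definition laplacian f : sphere R n -> R := divergence (grad f).

Definition supnorm (f : sphere R n -> R) : \bar R :=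
  ereal_sup (range (fun x => `|f x|%:E)).

Definition C1norm W : \bar R :=
  (supnorm W + supnorm (fun x => enorm (grad W x)))%E.

Definition C1norm_field V : \bar R :=
  (supnorm (fun x => enorm (V x)) + supnorm (fun x => enorm (cov V x)))%E.

(* The geodesic distance of S^n is the great-circle distance. *)
Definition geodesic_ball (x : sphere R n) (r : R) : set (sphere R n) :=
  [set y | acos (dot (x : 'rV[R]_n.+1) y) < r].

Definition vanishing_order u (x0 : sphere R n) : \bar R :=
  ereal_inf [set d%:E | d in [set d : R | 0 < d /\
    (0 < limf_esup (fun r : R => ((r `^ d)^-1)%:E *
      poweR (((r ^+ n)^-1)%:E *
        \int[sphere_vol R n]_(x in geodesic_ball x0 r) (`|u x| ^+ 2)%:E) 2^-1)
      0^'+)%E]].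

(* u is in H^1(S^n) with weak gradient G; H^1 is the completion of the smooth
   functions for the norm (|u|_2^2 + |grad u|_2^2)^(1/2). *)
Definition H1 u (G : sphere R n -> 'rV[R]_n.+1) : Prop :=
  [/\ measurable_fun setT u,
      (forall i, measurable_fun setT (fun x => G x 0 i)) &
      exists v : nat -> sphere R n -> R,
      [/\ (forall j, smooth (v j)),
          (\int[sphere_vol R n]_x (`|v j x - u x| ^+ 2)%:E)%E
            @[j --> \oo] --> 0%E &
          (\int[sphere_vol R n]_x (enorm (grad (v j) x - G x) ^+ 2)%:E)%E
            @[j --> \oo] --> 0%E]].

(* Weak formulation of Delta u + <V, grad u> + W u = 0. *)
Definition weak_solution V W u (G : sphere R n -> 'rV[R]_n.+1) : Prop :=
  forall psi, smooth psi ->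
    (\int[sphere_vol R n]_x
       (- dot (G x) (grad psi x) + dot (V x) (G x) * psi x
        + W x * u x * psi x)%:E = 0)%E.

Definition H1_solution V W u : Prop := exists2 G, H1 u G & weak_solution V W u G.

Definition nontrivial u : Prop := ~ {ae sphere_vol R n, forall x, u x = 0}.

(* C may depend on (S^n, alpha, beta) only. Both norms are finite here; poweR is
   the power function on extended reals. *)
Definition uniform_bound (alpha beta : R) : Prop :=
  exists2 C : R, 0 < C &
    forall W V, sphere_Ck 1 W -> tangent V -> sphere_Ck 1 V ->
    forall u, H1_solution V W u -> nontrivial u ->
    forall x0, (vanishing_order u x0 <
      C%:E * (1 + poweR (C1norm W) beta + poweR (C1norm_field V) alpha))%E.

Definition h (k : nat) (x : sphere R n) : R :=
  let y : 'rV[R]_n.+1 := x in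
  complex.Re ((y 0 ord0 +i* y 0 (inord 1))%C ^+ k).

Definition phi f (k : nat) (x : sphere R n) : R := expR (k%:R * f x) * h k x.

Definition Vk f (k : nat) (x : sphere R n) : 'rV[R]_n.+1 := (2 * k%:R) *: grad f x.

Definition Wk f (k : nat) (x : sphere R n) : R :=
  k%:R * laplacian f x - k%:R ^+ 2 * enorm (grad f x) ^+ 2
  - k%:R * (k%:R + n%:R - 1).

End Geometry.
Arguments uniform_bound {R} n alpha beta.

(* Main.v *)
(** A function on the sphere is studied through its extension to R^(n+1) \ {0}
    that is homogeneous of degree 0: by Euler's relation, its spherical gradient
    and Laplacian are the flat ones at points of the sphere. As the polynomial
    Re (x_1 + i x_2)^k is harmonic and homogeneous of degree k, this gives
    - Delta h_k = k (k + n - 1) h_k and, by the product rule, the equation for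
    phi_k.

    At a maximum point of f one has grad f = 0 and Delta f <= 0, hence
    |W_k| >= k^2 there for every k; the other three bounds only use that f is
    non-constant and that a continuous function on the sphere is bounded.

    On the geodesic ball of radius r around the pole |h_k| <= (2 r)^k, and |h_k|
    is at least c r^k on a part of this ball that has measure at least c r^n, by
    comparison of the cones over these sets with boxes in R^(n+1).

    For sharpness take V = 0, W = k (k + n - 1) and u = h_k. The weak equation is
    Green's formula on the sphere, obtained by integrating over R^(n+1) the
    divergence of g_j(|y|^2) psi grad u, with compactly supported radial cutoffs
    g_j, and letting j tend to infinity. *)

Require Import Defs.
From mathcomp Require Import all_boot all_order all_algebra.
From mathcomp Require Import all_classical all_reals all_analysis.
From mathcomp Require Import complex measurable_realfun ring lra.

Set Implicit Arguments.
Unset Strict Implicit.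
Unset Printing Implicit Defensive.

Import Order.TTheory GRing.Theory Num.Theory.
Import numFieldNormedType.Exports.

Local Open Scope classical_set_scope.
Local Open Scope ring_scope.

(** * Calculus of C^k functions away from the origin *)

Section Differentiability.
Context {R : realType} {V W : normedModType R}.

(** The extension of a function to R^(n+1) is in general discontinuous at the origin. Regularity is
    therefore confined to y <> 0, an open set on which formulas may be differentiated freely.
    Homogeneity links the sphere to the ambient space: the flat gradient and Laplacian of an
    extension have degrees -1 and -2, whence the factors |y| and |y|^2 each time a spherical
    quantity is extended again.

    Integrals on the sphere are by definition integrals over the punctured unit ball. This shapes
    the argument for Green's formula: only compactly supported C^1 fields on R^(n+1) have to be
    integrated, and for these Fubini and the one-variable fundamental theorem of calculus suffice.
    The cutoffs vanish near 0 to remove the singularity of the extensions.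

    The order k at the pole comes from a mass of exact size r^(2k+n) on the ball of radius r: after
    division by r^n its square root has size r^k. For h_k the potential has norm of size k^2, and
    this is what forces the exponent 1/2. *)

Lemma near_eq_differentiable (f g : V -> W) (a : V) :
  (\near a, f a = g a) -> differentiable f a -> differentiable g a.
Proof.
move=> fg df.
have fg0 : \forall h \near (0 : V), f (h + a) = g (h + a).
  have := fg; rewrite (near_shift 0 a) /=; apply: filterS => h /=.
  by rewrite subr0.
have fga : f a = g a by exact: nbhs_singleton fg.
have H : g \o shift a = cst (g a) + 'd f a +o_ 0 id.
  apply/eqaddoP => eps e0.
  have /diff_locally/eqaddoP/(_ _ e0) := df.
  move=> Hf; near=> h.
  have : `|(f \o shift a - (cst (f a) + 'd f a)) h| <= eps * `|h| by near: h.
  rewrite /= !fctE /= (_ : f (h + a) = g (h + a)) ?fga//.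
  by near: h.
apply/diff_locallyP; have Dg : 'd g a = 'd f a :> (V -> W).
  exact: (diff_unique (diff_continuous df)).
by rewrite Dg; split => //; exact: diff_continuous.
Unshelve. all: by end_near. Qed.

End Differentiability.

Section DeriveComp.
Context {R : realType} {V : normedModType R}.

Lemma differentiable_comp1 (g : R -> R) (F : V -> R) x :
  derivable g (F x) 1 -> differentiable F x -> differentiable (g \o F) x.
Proof. by move=> /derivable1_diffP dg dF; exact: differentiable_comp. Qed.

Lemma derive_comp1 (g : R -> R) (F : V -> R) x v :
  derivable g (F x) 1 -> differentiable F x ->
  'D_v (g \o F) x = 'D_1 g (F x) * 'D_v F x.
Proof.
move=> dg dF; rewrite deriveE; last exact: differentiable_comp1.
rewrite diff_comp//=; last exact/derivable1_diffP.
by rewrite (deriv1E dg) -(deriveE _ dF) derive1E mulrC.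
Qed.

End DeriveComp.

Section CkCalculus.
Context {R : realType} {n : nat}.
Local Notation E := 'rV[R]_n.+1.
Implicit Types (x y v : E).

Lemma near_neq0 x : x != 0 -> \forall y \near x, y != 0.
Proof.
move=> x0; have : \forall y \near x, `|y| != 0.
  apply: (@norm_continuous R E x [set z | z != 0]).
  by apply: open_nbhs_nbhs; split; [exact: open_neq|rewrite /= normr_eq0].
by apply: filterS => y; rewrite normr_eq0.
Qed.

Lemma near_eq_off0 (T : Type) (F G : E -> T) x :
  (forall y, y != 0 -> F y = G y) -> x != 0 -> \near x, F x = G x.
Proof. by move=> FG x0; near=> y; apply: FG; near: y; exact: near_neq0.
Unshelve. all: by end_near. Qed.

Lemma eq_off0_derive (W : normedModType R) (F G : E -> W) v x :
  (forall y, y != 0 -> F y = G y) -> x != 0 -> 'D_v F x = 'D_v G x.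
Proof. by move=> FG x0; apply: near_eq_derive; exact: near_eq_off0. Qed.

(** Main tool for regularity: an explicit formula valid off the origin is enough. The value at 0,
    where [radial] takes the default [north], never matters, because derivatives at y <> 0 only see
    a neighbourhood of y. *)
Lemma eq_Ck k (W : normedModType R) (F G : E -> W) :
  (forall y, y != 0 -> F y = G y) -> Ck k F -> Ck k G.
Proof.
elim: k F G => [|k IH] F G FG /=.
  move=> cF x x0; rewrite /prop_for/continuous_at -(FG _ x0).
  exact: cvg_trans (near_eq_cvg (near_eq_off0 FG x0)) (cF x x0).
move=> [dF DF]; split=> [x x0|v].
  by apply: near_eq_differentiable (dF x x0); exact: near_eq_off0.
by apply: IH (DF v) => y y0; exact: eq_off0_derive.
Qed.

Lemma CkW k (W : normedModType R) (F : E -> W) : Ck k.+1 F -> Ck k F.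
Proof.
elim: k F => [|k IH] F [dF DF].
  by move=> x x0; apply: differentiable_continuous; exact: dF.
by split => // v; exact: IH.
Qed.

Lemma Ck_le j k (W : normedModType R) (F : E -> W) : (j <= k)%N -> Ck k F -> Ck j F.
Proof.
by move=> /subnK <-; elim: (k - j)%N => // m IH H; apply: IH; exact: CkW.
Qed.

Lemma Ck_continuous k (W : normedModType R) (F : E -> W) x :
  Ck k F -> x != 0 -> {for x, continuous F}.
Proof. by elim: k F => [|k IH] F HF x0; [exact: HF|exact: IH (CkW HF) x0]. Qed.

Lemma Ck_derive k (W : normedModType R) (F : E -> W) v : Ck k.+1 F -> Ck k ('D_v F).
Proof. by move=> [_ DF]; exact: DF. Qed.

Lemma Ck_cst k (W : normedModType R) (c : W) : Ck k (cst c : E -> W).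
Proof.
elim: k c => [|k IH] c; first by move=> x _; exact: cst_continuous.
split=> [x _|v]; first exact: differentiable_cst.
by apply: eq_Ck (IH 0) => y _; rewrite derive_cst.
Qed.

Lemma deriveMR (F G : E -> R) v x : differentiable F x -> differentiable G x ->
  'D_v (fun y => F y * G y) x = F x * 'D_v G x + 'D_v F x * G x.
Proof.
move=> dF dG; rewrite deriveM; [|exact: diff_derivable|exact: diff_derivable].
by rewrite /GRing.scale/= [G x * _]mulrC.
Qed.

Lemma deriveDR (F G : E -> R) v x : differentiable F x -> differentiable G x ->
  'D_v (fun y => F y + G y) x = 'D_v F x + 'D_v G x.
Proof. by move=> dF dG; rewrite deriveD//; exact: diff_derivable. Qed.

Lemma deriveZR (F : E -> R) c v x : differentiable F x ->
  'D_v (fun y => c * F y) x = c * 'D_v F x.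
Proof.
move=> dF; rewrite deriveMR; [|exact: differentiable_cst|exact: dF].
by rewrite (derive_cst c) mul0r addr0.
Qed.

Lemma CkD k (F G : E -> R) : Ck k F -> Ck k G -> Ck k (fun y => F y + G y).
Proof.
elim: k F G => [|k IH] F G.
  by move=> cF cG x x0; exact: cvgD (cF x x0) (cG x x0).
move=> [dF DF] [dG DG]; split=> [x x0|v].
  by apply: differentiableD; [exact: dF|exact: dG].
apply: eq_Ck (IH _ _ (DF v) (DG v)) => y y0.
by rewrite deriveD//; apply: diff_derivable; [exact: dF|exact: dG].
Qed.

Lemma CkM k (F G : E -> R) : Ck k F -> Ck k G -> Ck k (fun y => F y * G y).
Proof.
elim: k F G => [|k IH] F G.
  by move=> cF cG x x0; exact: cvgM (cF x x0) (cG x x0).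
move=> CF CG; have [dF DF] := CF; have [dG DG] := CG; split=> [x x0|v].
  by apply: differentiableM; [exact: dF|exact: dG].
apply: eq_Ck (CkD (IH _ _ (CkW CF) (DG v)) (IH _ _ (CkW CG) (DF v))) => y y0.
by rewrite deriveM//; apply: diff_derivable; [exact: dF|exact: dG].
Qed.

Lemma CkZ k (c : R) (F : E -> R) : Ck k F -> Ck k (fun y => c * F y).
Proof. by move=> CF; apply: CkM => //; exact: Ck_cst. Qed.

Lemma CkN k (F : E -> R) : Ck k F -> Ck k (fun y => - F y).
Proof. by move=> CF; apply: eq_Ck (CkZ (-1) CF) => y _; rewrite mulN1r. Qed.

Lemma CkB k (F G : E -> R) : Ck k F -> Ck k G -> Ck k (fun y => F y - G y).
Proof. by move=> CF CG; apply: CkD => //; exact: CkN. Qed.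

Lemma CkX k m (F : E -> R) : Ck k F -> Ck k (fun y => F y ^+ m).
Proof.
move=> CF; elim: m => [|m IH]; first by apply: eq_Ck (Ck_cst k (1 : R)) => y _; rewrite expr0.
by apply: eq_Ck (CkM CF IH) => y _; rewrite exprS.
Qed.

Lemma Ck_sum k m (F : 'I_m -> E -> R) :
  (forall i, Ck k (F i)) -> Ck k (fun y => \sum_i F i y).
Proof.
elim: m F => [|m IH] F CF.
  by apply: eq_Ck (Ck_cst k (0 : R)) => y _; rewrite big_ord0.
apply: eq_Ck (CkD (CF ord0) (IH (fun i => F (lift ord0 i)) (fun i => CF _))) => y _.
by rewrite big_ord_recl.
Qed.

Lemma differentiable_coord_rV i x : differentiable (fun y : E => y 0 i) x.
Proof. exact: differentiable_coord. Qed.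

Lemma derive_coord i v x : 'D_v (fun y : E => y 0 i) x = v 0 i.
Proof.
rewrite -[RHS](_ : ('D_v id x) 0 i = _); last by rewrite derive_id.
by rewrite derive_mx ?mxE//; exact: derivable_id.
Qed.

Lemma Ck_coord k i : Ck k (fun y : E => y 0 i).
Proof.
case: k => [|k]; first by move=> x _; exact: coord_continuous.
split=> [x _|v]; first exact: differentiable_coord_rV.
by apply: eq_Ck (Ck_cst k (v 0 i)) => y _; rewrite derive_coord.
Qed.

Lemma Ck_expR k (F : E -> R) : Ck k F -> Ck k (fun y => expR (F y)).
Proof.
elim: k F => [|k IH] F.
  move=> cF x x0; apply: (@continuous_comp _ _ _ F expR); first exact: cF.
  exact: continuous_expR.
move=> CF; have [dF DF] := CF; split=> [x x0|v].
  by apply: (@differentiable_comp1 _ _ expR F) => //; exact: dF.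
apply: eq_Ck (CkM (IH _ (CkW CF)) (DF v)) => y y0.
rewrite [RHS](@derive_comp1 _ _ expR F)//; last exact: dF.
by rewrite derive_val.
Qed.

Lemma dotE (u w : E) : dot u w = \sum_i u 0 i * w 0 i.
Proof. by rewrite /dot big_ord1. Qed.

Lemma differentiable_dot y : differentiable (fun z : E => dot z z) y.
Proof.
have -> : (fun y : E => dot y y) =
    \sum_(i < n.+1) ((fun y : E => y 0 i) * (fun y : E => y 0 i)).
  by apply/funext => z; rewrite dotE fct_sumE.
by apply: differentiable_sum => i; apply: differentiableM;
  exact: differentiable_coord_rV.
Qed.

Lemma Ck_dot k : Ck k (fun y : E => dot y y).
Proof.
apply: eq_Ck (@Ck_sum k _ (fun i y => y 0 i * y 0 i) _) => [y _|i].
  by rewrite dotE.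
by apply: CkM; exact: Ck_coord.
Qed.

Lemma derive_dot v x : 'D_v (fun y : E => dot y y) x = 2 * dot x v.
Proof.
have -> : (fun y : E => dot y y) =
    \sum_(i < n.+1) ((fun y : E => y 0 i) * (fun y : E => y 0 i)).
  by apply/funext => y; rewrite dotE fct_sumE.
have d (i : 'I_n.+1) : derivable (fun y : E => y 0 i) x v.
  by apply: diff_derivable; exact: differentiable_coord_rV.
rewrite derive_sum; last by move=> i; exact: derivableM.
rewrite dotE mulr_sumr; apply: eq_bigr => i _.
by rewrite deriveM// !derive_coord /GRing.scale/=; ring.
Qed.

Lemma dot_eq0 x : (dot x x == 0) = (x == 0).
Proof.
rewrite dotE psumr_eq0; last by move=> i _; rewrite -expr2 sqr_ge0.
apply/allP/eqP => [H|-> i _]; last by rewrite mxE mulr0 eqxx.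
apply/rowP => i; rewrite mxE; apply/eqP.
by have := H i (mem_index_enum _); rewrite mulf_eq0 orbb.
Qed.

Lemma dot_gt0 x : x != 0 -> 0 < dot x x.
Proof. by move=> x0; rewrite lt0r dot_eq0 x0 dot_ge0. Qed.

Lemma enorm_gt0 x : x != 0 -> 0 < enorm x.
Proof. by move=> x0; rewrite sqrtr_gt0 dot_gt0. Qed.

Lemma enorm0 m1 m2 : enorm (0 : 'M[R]_(m1, m2)) = 0.
Proof.
by rewrite /enorm /dot big1 ?sqrtr0// => i _; rewrite big1// => j _; rewrite mxE mul0r.
Qed.

Lemma sqr_enorm x : enorm x ^+ 2 = dot x x.
Proof. by rewrite sqr_sqrtr// dot_ge0. Qed.

Lemma differentiable_enorm x : x != 0 -> differentiable (fun y : E => enorm y) x.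
Proof.
move=> x0; apply: (@differentiable_comp1 _ _ Num.sqrt (fun y : E => dot y y)).
  by have := is_derive1_sqrt (dot_gt0 x0).
exact: differentiable_dot.
Qed.

Lemma derive_enorm v x : x != 0 ->
  'D_v (fun y : E => enorm y) x = dot x v / enorm x.
Proof.
move=> x0; rewrite [LHS](@derive_comp1 _ _ Num.sqrt (fun y : E => dot y y)).
- rewrite derive_sqrt ?dot_gt0// derive_dot -/(enorm x) invfM mulrACA.
  by rewrite mulVf ?mul1r 1?mulrC// pnatr_eq0.
- by have := is_derive1_sqrt (dot_gt0 x0).
- exact: differentiable_dot.
Qed.

(** The inverse norm comes before the norm because its derivative - |y|^-3 <v, y> is again a
    polynomial in |y|^-1 and the coordinates, so the induction on k closes. The norm then follows as
    |y|^2 |y|^-1. *)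
Lemma Ck_invenorm k : Ck k (fun y : E => (enorm y)^-1).
Proof.
elim: k => [|k IH].
  move=> x x0; have e0 : enorm x != 0 by rewrite gt_eqF// enorm_gt0.
  exact: (cvgV e0 (differentiable_continuous (differentiable_enorm x0))).
split=> [x x0|v].
  by apply: differentiableV; [exact: differentiable_enorm|rewrite gt_eqF ?enorm_gt0].
apply: (@eq_Ck _ _ (fun y => - ((enorm y)^-1 ^+ 3 * \sum_i v 0 i * y 0 i))).
  move=> y y0; rewrite deriveV; last 2 first.
  - by rewrite gt_eqF// enorm_gt0.
  - exact/diff_derivable/differentiable_enorm.
  rewrite derive_enorm// dotE /GRing.scale/=.
  rewrite (eq_bigr (fun i => y 0 i * v 0 i)) => [|i _]; last by rewrite mulrC.
  by rewrite -exprVn; ring.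
apply: CkN; apply: CkM; first exact: CkX.
by apply: Ck_sum => i; apply: CkZ; exact: Ck_coord.
Qed.

Lemma Ck_enorm k : Ck k (fun y : E => enorm y).
Proof.
apply: eq_Ck (CkM (Ck_dot k) (Ck_invenorm k)) => y y0.
by rewrite -sqr_enorm expr2 mulfK// gt_eqF// enorm_gt0.
Qed.

End CkCalculus.

(** * Homogeneous extensions and the Laplacian on the sphere *)

Section Homogeneous.
Context {R : realType} {n : nat}.
Local Notation E := 'rV[R]_n.+1.
Local Notation "''e_' i" := (delta_mx 0 i : 'rV[R]_n.+1) (at level 8, i at level 2, format "''e_' i").
Implicit Types (x y v : E) (p : sphere R n).

Lemma dot_sphere p : dot p p = 1.
Proof. by case: p => y /= /eqP. Qed.

Lemma enorm_sphere p : enorm p = 1.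
Proof. by rewrite /enorm dot_sphere sqrtr1. Qed.

Lemma sphere_neq0 p : (p : E) != 0.
Proof. by rewrite -dot_eq0 dot_sphere oner_eq0. Qed.

Lemma enormZ (c : R) x : 0 <= c -> enorm (c *: x) = c * enorm x.
Proof. by move=> c0; rewrite /enorm dotZ sqrtrM ?sqr_ge0// sqrtr_sqr ger0_norm. Qed.

Lemma radialE y : y != 0 -> radial y = (enorm y)^-1 *: y :> E.
Proof. by move=> y0; rewrite val_radial dot_eq0 (negPf y0). Qed.

Lemma radialK p : radial p = p.
Proof. by apply/val_inj; rewrite /= radialE ?sphere_neq0// enorm_sphere invr1 scale1r. Qed.

Lemma radialZ (c : R) y : 0 < c -> radial (c *: y) = radial y.
Proof.
move=> c0; have [->|y0] := eqVneq y 0; first by rewrite scaler0.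
apply/val_inj; rewrite /= !radialE ?scaler_eq0 ?gt_eqF//.
by rewrite enormZ ?ltW// scalerA invfM mulrAC mulVf ?gt_eqF// mul1r.
Qed.

Lemma homextE (T : Type) (f : sphere R n -> T) p : homext f p = f p.
Proof. by rewrite /homext /= radialK. Qed.

Lemma homextZ (T : Type) (f : sphere R n -> T) (c : R) y : 0 < c ->
  homext f (c *: y) = homext f y.
Proof. by move=> c0; rewrite /homext /= radialZ. Qed.

(** Positive homogeneity of degree -m: each derivative lowers the degree by one, so [m] counts
    derivatives of a function of degree 0. *)
Definition homog (m : nat) (G : E -> R) :=
  forall (c : R) y, 0 < c -> y != 0 -> G (c *: y) = c^-1 ^+ m * G y.

Lemma homog_homext (f : sphere R n -> R) : homog 0 (homext f).
Proof. by move=> c y c0 _; rewrite homextZ// expr0 mul1r. Qed.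

Lemma derive_comp_scale (G : E -> R) c v y : differentiable G (c *: y) ->
  'D_v (fun z => G (c *: z)) y = c * 'D_v G (c *: y).
Proof.
move=> dG; have dc : differentiable ( *:%R c : E -> E) y.
  by apply: linear_differentiable; exact: scaler_continuous.
rewrite deriveE; last exact: (@differentiable_comp _ _ _ _ ( *:%R c) G).
rewrite (@diff_comp _ _ _ _ ( *:%R c) G)//= diff_lin; last exact: scaler_continuous.
by rewrite linearZ/= deriveE.
Qed.

(** Both sides of G (c z) = c^-m G z are differentiated in z; the chain rule gives one extra factor
    c on the left. *)
Lemma homog_derive m (G : E -> R) v : (forall y, y != 0 -> differentiable G y) ->
  homog m G -> homog m.+1 ('D_v G).
Proof.
move=> dG hG c y c0 y0.
have cy0 : c *: y != 0 by rewrite scaler_eq0 gt_eqF.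
have := @derive_comp_scale G c v y (dG _ cy0).
rewrite (@eq_off0_derive _ _ _ _ (fun z => c^-1 ^+ m * G z))//; last first.
  by move=> z z0; exact: hG.
rewrite deriveZR; last exact: dG.
move=> /(congr1 ( *%R c^-1)); rewrite mulKf ?gt_eqF// => <-.
by rewrite mulrA -exprS.
Qed.

Lemma homog_radial m (G : E -> R) y : homog m G -> y != 0 ->
  G (radial y) = enorm y ^+ m * G y.
Proof.
move=> hG y0; rewrite radialE// hG// ?invr_gt0 ?enorm_gt0//.
by rewrite invrK.
Qed.

(** The extension is constant on the open ray through y, so the difference quotient vanishes as soon
    as 1 + h > 0; no differentiability is involved. *)
Lemma derive_radial0 (W : normedModType R) (f : sphere R n -> W) y :
  'D_y (homext f) y = 0.
Proof.
rewrite /derive; apply/lim_near_cst => //; near=> h.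
rewrite /= (_ : h *: y + y = (1 + h) *: y); last by rewrite scalerDl scale1r addrC.
rewrite homextZ ?subrr ?scaler0// -ltrBlDl sub0r.
have : `|h| < 1.
  by near: h; apply: dnbhs0_lt.
by rewrite ltr_norml => /andP[].
Unshelve. all: by end_near. Qed.

Lemma derive_coords (W : normedModType R) (F : E -> W) v y : differentiable F y ->
  'D_v F y = \sum_i v 0 i *: 'D_('e_i) F y.
Proof.
move=> dF; rewrite deriveE// {1}[v]row_sum_delta linear_sum.
by apply: eq_bigr => i _; rewrite linearZ/= deriveE.
Qed.

Lemma differentiable_row m (G : 'I_m -> E -> R) y :
  (forall i, differentiable (G i) y) ->
  differentiable (fun z => \row_i G i z) y.
Proof.
move=> dG.
have -> : (fun z => \row_i G i z) = \sum_i (fun z => G i z *: delta_mx 0 i).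
  apply/funext => z; rewrite fct_sumE [LHS]row_sum_delta.
  by apply: eq_bigr => i _; rewrite mxE.
by apply: differentiable_sum => i; exact: differentiableZl.
Qed.

Lemma euler_homext (f : sphere R n -> R) y : differentiable (homext f) y ->
  \sum_i y 0 i * 'D_('e_i) (homext f) y = 0.
Proof. by move=> df; have := derive_radial0 f y; rewrite derive_coords. Qed.

End Homogeneous.

Section GeometryFormulas.
Context {R : realType} {n : nat}.
Local Notation E := 'rV[R]_n.+1.
Local Notation "''e_' i" := (delta_mx 0 i : 'rV[R]_n.+1) (at level 8, i at level 2, format "''e_' i").
Implicit Types (x y v : E) (p : sphere R n) (f g : sphere R n -> R).

Definition lap (F : E -> R) y : R := \sum_i 'D_('e_i) ('D_('e_i) F) y.

Lemma sphere_CkS k f : sphere_Ck k.+1 f -> sphere_Ck 1 f.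
Proof. exact: Ck_le. Qed.

Lemma gradE f p i : grad f p 0 i = 'D_('e_i) (homext f) p.
Proof. by rewrite mxE. Qed.

(** The flat gradient of the extension has degree -1, so evaluating it at y / |y| multiplies it by
    |y|. *)
Lemma homext_grad f y i : sphere_Ck 1 f -> y != 0 ->
  homext (grad f) y 0 i = enorm y * 'D_('e_i) (homext f) y.
Proof.
move=> [df _] y0; rewrite /homext /= gradE.
by rewrite (homog_radial (homog_derive _ _ (homog_homext f))) ?expr1.
Qed.

Lemma sphere_Ck_grad k f i : sphere_Ck k.+1 f ->
  sphere_Ck k (fun p => grad f p 0 i).
Proof.
move=> Cf; have C1f := sphere_CkS Cf.
apply: (@eq_Ck _ _ k _ (fun y => enorm y * 'D_('e_i) (homext f) y)).
  by move=> y y0; rewrite -homext_grad.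
by apply: CkM; [exact: Ck_enorm|exact: Ck_derive].
Qed.

Lemma differentiable_homext_row (V : sphere R n -> E) y :
  (forall i, differentiable (homext (fun p => V p 0 i)) y) ->
  differentiable (homext V) y.
Proof.
move=> dV; rewrite (_ : homext V = fun z => \row_i homext (fun p => V p 0 i) z).
  exact: differentiable_row.
by apply/funext => z; apply/rowP => i; rewrite mxE.
Qed.

Lemma jacobianE (V : E -> E) y i j : differentiable V y ->
  'J V y i j = 'D_('e_i) (fun z => V z 0 j) y.
Proof.
move=> dV; rewrite [LHS]mxE -deriveE// derive_mx ?mxE//.
exact: diff_derivable.
Qed.

(** The projection in [cov] does not change the trace: by cyclicity the trace of J x^T x is (x J)
    x^T, and x J is the radial derivative of the extension, which is 0. *)
Lemma divergenceE (V : sphere R n -> E) p : differentiable (homext V) (p : E) ->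
  divergence V p = \sum_i 'D_('e_i) (homext (fun q => V q 0 i)) p.
Proof.
move=> dV; rewrite /divergence /cov mulmxBr mulmx1 linearB/=.
rewrite mulmxA mxtrace_mulC mulmxA -deriveEjacobian// derive_radial0.
rewrite mul0mx linear0 subr0 /mxtrace.
by apply: eq_bigr => i _; rewrite jacobianE.
Qed.

(** The extension of the gradient is |y| times the flat gradient. Differentiating the factor |y|
    produces the sum of x_i D_i f, which vanishes by Euler's relation. *)
Lemma laplacianE f p : sphere_Ck 2 f ->
  laplacian f p = lap (homext f) p.
Proof.
move=> Cf; have C1f := sphere_CkS Cf.
have p0 := sphere_neq0 p.
rewrite /laplacian divergenceE; last first.
  apply: differentiable_homext_row => i.
  by have [d _] := sphere_Ck_grad i Cf; exact: d.
rewrite (eq_bigr (fun i => (p : E) 0 i * 'D_('e_i) (homext f) p +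
    'D_('e_i) ('D_('e_i) (homext f)) p)); last first.
  move=> i _.
  rewrite (@eq_off0_derive _ _ _ _ (fun y => enorm y * 'D_('e_i) (homext f) y))//; last first.
    by move=> y y0; rewrite -homext_grad.
  rewrite deriveMR; last 2 first.
  - exact: differentiable_enorm.
  - by have [_ d] := Cf; have [{}d _] := d 'e_i; exact: d.
  rewrite derive_enorm// enorm_sphere mul1r divr1 addrC dotE; congr (_ * _ + _).
  rewrite (bigD1 i)//= mxE !eqxx mulr1 big1 ?addr0// => j ji.
  by rewrite mxE (negPf ji) andbF mulr0.
rewrite big_split/= euler_homext ?add0r//.
by have [d _] := C1f; exact: d.
Qed.

Lemma homext_laplacian f y : sphere_Ck 2 f -> y != 0 ->
  homext (laplacian f) y = dot y y * lap (homext f) y.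
Proof.
move=> Cf y0; rewrite {1}/homext /= laplacianE// /lap mulr_sumr; apply: eq_bigr => i _.
have [d1 d2] := Cf.
rewrite (homog_radial (homog_derive _ _ (homog_derive _ d1 (homog_homext f))))//.
  by rewrite sqr_enorm.
by have [{}d2 _] := d2 'e_i.
Qed.

Lemma sphere_Ck_laplacian k f : sphere_Ck k.+2 f -> sphere_Ck k (laplacian f).
Proof.
move=> Cf; have C2f : sphere_Ck 2 f by exact: Ck_le Cf.
apply: (@eq_Ck _ _ k _ (fun y => dot y y * lap (homext f) y)).
  by move=> y y0; rewrite -homext_laplacian.
apply: CkM; first exact: Ck_dot.
by apply: Ck_sum => i; do 2 apply: Ck_derive.
Qed.

Lemma homext_dot_grad f g y : sphere_Ck 1 f -> sphere_Ck 1 g -> y != 0 ->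
  homext (fun p => dot (grad f p) (grad g p)) y =
  dot y y * \sum_i 'D_('e_i) (homext f) y * 'D_('e_i) (homext g) y.
Proof.
move=> Cf Cg y0; rewrite {1}/homext /= dotE mulr_sumr; apply: eq_bigr => i _.
have := homext_grad i Cf y0; have := homext_grad i Cg y0.
by rewrite /homext /= => -> ->; rewrite mulrACA -expr2 sqr_enorm.
Qed.

End GeometryFormulas.

(** * Flat Laplacians of products, exponentials and powers of the norm *)

Section FlatLaplacian.
Context {R : realType} {n : nat}.
Local Notation E := 'rV[R]_n.+1.
Local Notation "''e_' i" := (delta_mx 0 i : 'rV[R]_n.+1) (at level 8, i at level 2, format "''e_' i").
Implicit Types (x y v : E) (F G : E -> R).

Lemma C2_diff2 F v y : Ck 2 F -> y != 0 -> differentiable ('D_v F) y.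
Proof. by move=> [_ d2]; have [{}d2 _] := d2 v; exact: d2. Qed.

Lemma lapM F G y : Ck 2 F -> Ck 2 G -> y != 0 ->
  lap (fun z => F z * G z) y =
  F y * lap G y + 2 * \sum_i 'D_('e_i) F y * 'D_('e_i) G y + lap F y * G y.
Proof.
move=> CF CG y0; have [dF _] := CF; have [dG _] := CG.
rewrite /lap mulr_sumr mulr_sumr mulr_suml -!big_split/=; apply: eq_bigr => i _.
rewrite (@eq_off0_derive _ _ _ _ (fun z => F z * 'D_('e_i) G z + 'D_('e_i) F z * G z))//.
  have [d2F d2G] := (C2_diff2 'e_i CF y0, C2_diff2 'e_i CG y0).
  rewrite deriveDR; last 2 first.
  - by apply: differentiableM => //; exact: dF.
  - by apply: differentiableM => //; exact: dG.
  rewrite !deriveMR//; [|exact: dG|exact: dF].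
  move: ('D_('e_i) ('D_('e_i) G) y) ('D_('e_i) ('D_('e_i) F) y) => g2 f2.
  by move: ('D_('e_i) F y) ('D_('e_i) G y) (F y) (G y) => a b c d; ring.
by move=> z z0; rewrite deriveMR//; [exact: dF|exact: dG].
Qed.

Lemma derive_expR F v y : differentiable F y ->
  'D_v (fun z => expR (F z)) y = expR (F y) * 'D_v F y.
Proof.
by move=> dF; rewrite [LHS](@derive_comp1 _ _ expR F)// derive_val.
Qed.

Lemma lap_expR F y : Ck 2 F -> y != 0 ->
  lap (fun z => expR (F z)) y = expR (F y) * (lap F y + \sum_i 'D_('e_i) F y ^+ 2).
Proof.
move=> CF y0; have [dF _] := CF.
rewrite /lap mulrDr !mulr_sumr -big_split/=; apply: eq_bigr => i _.
rewrite (@eq_off0_derive _ _ _ _ (fun z => expR (F z) * 'D_('e_i) F z))//.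
  rewrite deriveMR; last 2 first.
  - by apply: (@differentiable_comp1 _ _ expR F) => //; exact: dF.
  - exact: C2_diff2.
  by rewrite derive_expR; [ring|exact: dF].
by move=> z z0; rewrite derive_expR//; exact: dF.
Qed.

Lemma lapZ (c : R) F y : Ck 2 F -> y != 0 -> lap (fun z => c * F z) y = c * lap F y.
Proof.
move=> CF y0; have [dF _] := CF.
rewrite /lap mulr_sumr; apply: eq_bigr => i _.
rewrite (@eq_off0_derive _ _ _ _ (fun z => c * 'D_('e_i) F z))//.
  by rewrite deriveZR//; exact: C2_diff2.
by move=> z z0; rewrite deriveZR//; exact: dF.
Qed.

Lemma derive_invenorm m v y : y != 0 ->
  'D_v (fun z : E => (enorm z)^-1 ^+ m) y = - m%:R * dot y v * (enorm y)^-1 ^+ m.+2.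
Proof.
move=> y0; elim: m => [|m IH].
  by under eq_fun do rewrite expr0; rewrite derive_cst oppr0 !mul0r.
have [d1 _] := @Ck_invenorm R n 1; have [dm _] := CkX m (@Ck_invenorm R n 1).
under eq_fun do rewrite exprS.
rewrite deriveMR ?IH; [|exact: d1|exact: dm].
rewrite deriveV; last 2 first.
- by rewrite gt_eqF// enorm_gt0.
- exact/diff_derivable/differentiable_enorm.
rewrite derive_enorm// /GRing.scale/= -[enorm y ^- 2]exprVn -[(m.+1)%:R]natr1.
set N := (enorm y)^-1; rewrite !exprS expr0; move: (N ^+ m) (dot y v) => a b; ring.
Qed.

Lemma derive_dotl v w y : 'D_v (fun z : E => dot z w) y = dot v w.
Proof.
have -> : (fun z : E => dot z w) = \sum_(i < n.+1) ((fun z : E => z 0 i) * cst (w 0 i)).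
  by apply/funext => z; rewrite dotE fct_sumE.
rewrite derive_sum => [|i]; last first.
  apply: diff_derivable; apply: differentiableM; last exact: differentiable_cst.
  exact: differentiable_coord_rV.
rewrite dotE; apply: eq_bigr => i _; have dc := differentiable_coord_rV i y.
rewrite [LHS](deriveMR v dc); last exact: differentiable_cst.
by rewrite derive_cst mulr0 add0r derive_coord.
Qed.

Lemma Ck_dotl k w : Ck k (fun z : E => dot z w).
Proof.
apply: (@eq_Ck _ _ _ _ (fun z : E => \sum_i w 0 i * z 0 i)) => [y _|].
  by rewrite dotE; apply: eq_bigr => i _; rewrite mulrC.
by apply: Ck_sum => i; apply: CkZ; exact: Ck_coord.
Qed.

Lemma dot_delta (x : E) i : dot x 'e_i = x 0 i.
Proof.
rewrite dotE (bigD1 i)//= mxE !eqxx mulr1 big1 ?addr0// => j ji.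
by rewrite mxE (negPf ji) andbF mulr0.
Qed.

(** In dimension N = n + 1 the Laplacian of |y|^-m is m (m + 2 - N) |y|^(-m-2), here evaluated at
    |y| = 1. *)
Lemma lap_invenorm m (p : sphere R n) :
  lap (fun z : E => (enorm z)^-1 ^+ m) p = m%:R * (m%:R + 1 - n%:R).
Proof.
have p0 := sphere_neq0 p.
rewrite /lap (eq_bigr (fun i => - m%:R + m%:R * m.+2%:R * ((p : E) 0 i * (p : E) 0 i))).
  rewrite big_split/= -mulr_sumr -dotE dot_sphere sumr_const card_ord.
  rewrite -[n.+1]addn1 -[m.+2]addn2 mulrnAr 1?mulrC -mulr_natr ?natrD; ring.
move=> i _.
rewrite (@eq_off0_derive _ _ _ _ (fun z => - m%:R * (dot z 'e_i * (enorm z)^-1 ^+ m.+2)))//.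
  have [d1 _] := Ck_dotl 1 'e_i.
  have [dm _] := CkX m.+2 (@Ck_invenorm R n 1).
  rewrite deriveZR; last by apply: differentiableM; [exact: d1|exact: dm].
  rewrite deriveMR; [|exact: d1|exact: dm].
  rewrite derive_dotl derive_invenorm// enorm_sphere invr1 !expr1n !dot_delta mxE !eqxx.
  by rewrite /=; ring.
by move=> z z0; rewrite derive_invenorm// -mulrA.
Qed.

End FlatLaplacian.

(** * The harmonic polynomials and the equation for phi_k *)

Section HarmonicPolynomials.
Context {R : realType} {n : nat}.
Local Notation E := 'rV[R]_n.+1.
Local Notation "''e_' i" := (delta_mx 0 i : 'rV[R]_n.+1) (at level 8, i at level 2, format "''e_' i").
Implicit Types (x y v : E).

(** The imaginary part is carried along because recursion and differentiation of (x_1 + i x_2)^k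
    couple the two parts. *)
Definition hre (k : nat) y : R := complex.Re ((y 0 ord0 +i* y 0 (inord 1))%C ^+ k).
Definition him (k : nat) y : R := complex.Im ((y 0 ord0 +i* y 0 (inord 1))%C ^+ k).

Lemma hre0 y : hre 0 y = 1. Proof. by rewrite /hre expr0. Qed.
Lemma him0 y : him 0 y = 0. Proof. by rewrite /him expr0. Qed.

Lemma hreS k y : hre k.+1 y = y 0 ord0 * hre k y - y 0 (inord 1) * him k y.
Proof. by rewrite /hre /him exprS; case: (_ ^+ k). Qed.

Lemma himS k y : him k.+1 y = y 0 ord0 * him k y + y 0 (inord 1) * hre k y.
Proof. by rewrite /hre /him exprS; case: (_ ^+ k). Qed.

Lemma hre_himZ k (c : R) y :
  hre k (c *: y) = c ^+ k * hre k y /\ him k (c *: y) = c ^+ k * him k y.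
Proof.
elim: k => [|k [IH1 IH2]]; first by rewrite !hre0 !him0 expr0 mulr0 mulr1.
by rewrite !hreS !himS IH1 IH2 !mxE exprS; split; ring.
Qed.

Lemma Ck_hre_him j k : Ck j (hre k) /\ Ck j (him k).
Proof.
elim: k => [|k [IH1 IH2]].
  by split; [apply: eq_Ck (Ck_cst j (1 : R))|apply: eq_Ck (Ck_cst j (0 : R))] => y _;
    rewrite ?hre0 ?him0.
split.
- apply: (@eq_Ck _ _ _ _ (fun y => y 0 ord0 * hre k y - y 0 (inord 1) * him k y)).
    by move=> y _; rewrite hreS.
  by apply: CkB; apply: CkM => //; exact: Ck_coord.
- apply: (@eq_Ck _ _ _ _ (fun y => y 0 ord0 * him k y + y 0 (inord 1) * hre k y)).
    by move=> y _; rewrite himS.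
  by apply: CkD; apply: CkM => //; exact: Ck_coord.
Qed.

Lemma differentiable_hre_him k y : differentiable (hre k) y /\ differentiable (him k) y.
Proof.
elim: k => [|k [IH1 IH2]].
  rewrite (_ : hre 0 = cst 1); last by apply/funext => z; rewrite hre0.
  rewrite (_ : him 0 = cst 0); last by apply/funext => z; rewrite him0.
  by split; exact: differentiable_cst.
rewrite (_ : hre k.+1 = fun y => y 0 ord0 * hre k y - y 0 (inord 1) * him k y); last first.
  by apply/funext => z; rewrite hreS.
rewrite (_ : him k.+1 = fun y => y 0 ord0 * him k y + y 0 (inord 1) * hre k y); last first.
  by apply/funext => z; rewrite himS.
split.
- apply: differentiableB; apply: differentiableM => //; exact: differentiable_coord_rV.
- apply: differentiableD; apply: differentiableM => //; exact: differentiable_coord_rV.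
Qed.

(** Real and imaginary parts of the complex rule D_v z^k = k v z^(k-1). The truncated [k.-1] is
    harmless at k = 0, where the factor k vanishes. *)
Lemma derive_hre_him k v y :
  'D_v (hre k) y = k%:R * (v 0 ord0 * hre k.-1 y - v 0 (inord 1) * him k.-1 y) /\
  'D_v (him k) y = k%:R * (v 0 ord0 * him k.-1 y + v 0 (inord 1) * hre k.-1 y).
Proof.
elim: k => [|k [IH1 IH2]].
  rewrite (_ : hre 0 = cst 1); last by apply/funext => z; rewrite hre0.
  rewrite (_ : him 0 = cst 0); last by apply/funext => z; rewrite him0.
  by rewrite !derive_cst !mul0r.
rewrite /=.
rewrite {1}(_ : hre k.+1 = fun y => y 0 ord0 * hre k y + (-1) * (y 0 (inord 1) * him k y)); last first.
  by apply/funext => z; rewrite hreS mulN1r.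
rewrite {1}(_ : him k.+1 = fun y => y 0 ord0 * him k y + y 0 (inord 1) * hre k y); last first.
  by apply/funext => z; rewrite himS.
have [d1 d2] := differentiable_hre_him k y.
have c0 := differentiable_coord_rV ord0 y.
have c1 := differentiable_coord_rV (inord 1) y.
rewrite !deriveDR; [|exact: differentiableM|exact: differentiableM|exact: differentiableM|].
  rewrite deriveZR; last exact: differentiableM.
  rewrite !deriveMR// !derive_coord IH1 IH2.
  case: k {IH1 IH2 d1 d2} => [|k]; first by rewrite hre0 him0 !mul0r /=; split; ring.
  by rewrite !hreS !himS -[(k.+2)%:R]natr1 /=; split; ring.
by apply: differentiableM; [exact: differentiable_cst|exact: differentiableM].
Qed.

Lemma derive_hre_self k y : 'D_y (hre k) y = k%:R * hre k y.
Proof.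
case: k => [|k]; first by rewrite (derive_hre_him 0 y y).1 !mul0r.
by rewrite (derive_hre_him k.+1 y y).1 -hreS.
Qed.

(** The second derivatives along x_1 and x_2 are opposite and all others vanish. The hypothesis 0 <
    n makes [inord 1] a genuine second coordinate, distinct from [ord0]. *)
Lemma lap_hre k y : (0 < n)%N -> lap (hre k) y = 0.
Proof.
move=> n0; have i10 : inord 1 != ord0 :> 'I_n.+1 by rewrite -val_eqE/= inordK.
have e (i j : 'I_n.+1) : 'e_i 0 j = (i == j)%:R by rewrite mxE eqxx eq_sym.
rewrite /lap (eq_bigr (fun i : 'I_n.+1 => k%:R * k.-1%:R *
   (hre k.-2 y * ((i == ord0)%:R * (i == ord0)%:R - (i == inord 1)%:R * (i == inord 1)%:R)
    - 2 * him k.-2 y * ((i == ord0)%:R * (i == inord 1)%:R)))); last first.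
  move=> i _.
  rewrite (_ : 'D_('e_i) (hre k) = fun z => k%:R * ((i == ord0)%:R * hre k.-1 z
     + (- (i == inord 1)%:R) * him k.-1 z)); last first.
    by apply/funext => z; rewrite (derive_hre_him k 'e_i z).1 mulNr !e.
  have [d1 d2] := differentiable_hre_him k.-1 y.
  rewrite deriveZR; last first.
    by apply: differentiableD; apply: differentiableM => //; exact: differentiable_cst.
  rewrite deriveDR; [|by apply: differentiableM => //; exact: differentiable_cst..].
  rewrite !deriveZR// (derive_hre_him k.-1 'e_i y).1 (derive_hre_him k.-1 'e_i y).2 !e.
  move: (hre _ _) (him _ _) (k%:R) (k.-1%:R) => a b c d; ring.
rewrite -mulr_sumr sumrB -!mulr_sumr sumrB.
have s (j : 'I_n.+1) : \sum_(i < n.+1) (i == j)%:R * (i == j)%:R = 1 :> R.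
  rewrite (bigD1 j)//= eqxx mulr1 big1 ?addr0// => i ij.
  by rewrite (negPf ij) mulr0.
rewrite !s subrr mulr0 sub0r big1 ?mulr0 ?oppr0 ?mulr0// => i _.
by have [->|] := eqVneq i ord0; rewrite ?mul0r// eq_sym (negPf i10) mulr0.
Qed.

Lemma homext_h k y : y != 0 -> homext (@h R n k) y = hre k y * (enorm y)^-1 ^+ k.
Proof.
move=> y0; rewrite /homext /= /h -/(hre k _) radialE// (hre_himZ _ _ _).1.
by rewrite mulrC.
Qed.

Lemma smooth_h k : smooth (@h R n k).
Proof.
move=> j; apply: (@eq_Ck _ _ _ _ (fun y => hre k y * (enorm y)^-1 ^+ k)).
  by move=> y y0; rewrite homext_h.
by apply: CkM; [exact: (Ck_hre_him j k).1|apply: CkX; exact: Ck_invenorm].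
Qed.

Lemma eq_lap (F G : E -> R) y : (forall z, z != 0 -> F z = G z) -> y != 0 ->
  lap F y = lap G y.
Proof.
move=> FG y0; apply: eq_bigr => i _; apply: eq_off0_derive => // z z0.
exact: eq_off0_derive.
Qed.

(** The extension is P |y|^-k with P harmonic and homogeneous of degree k. The cross term of the
    product rule is - 2 k^2 P by Euler's relation for P, and the Laplacian of |y|^-k contributes k
    (k + 1 - n) P; the sum is - k (k + n - 1) P. *)
Lemma lap_homext_h k (p : sphere R n) : (0 < n)%N ->
  lap (homext (@h R n k)) p = - (k%:R * (k%:R + n%:R - 1)) * h k p.
Proof.
move=> n0; have p0 := sphere_neq0 p.
rewrite (@eq_lap _ (fun y => hre k y * (enorm y)^-1 ^+ k))//; last first.
  by move=> z z0; rewrite homext_h.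
rewrite lapM//; [|exact: (Ck_hre_him 2 k).1|apply: CkX; exact: Ck_invenorm].
rewrite lap_hre// lap_invenorm mul0r addr0.
rewrite (eq_bigr (fun i => - k%:R * ((p : E) 0 i * 'D_('e_i) (hre k) p))); last first.
  move=> i _; rewrite derive_invenorm// enorm_sphere invr1 expr1n dot_delta; ring.
rewrite -mulr_sumr.
have := derive_hre_self k p; rewrite derive_coords; last exact: (differentiable_hre_him k p).1.
rewrite [X in X = _](_ : _ = \sum_i (p : E) 0 i * 'D_('e_i) (hre k) p)// => ->.
rewrite /h -/(hre k _); ring.
Qed.

End HarmonicPolynomials.

Section LaplacianPhi.
Context {R : realType} {n : nat}.
Local Notation E := 'rV[R]_n.+1.
Local Notation "''e_' i" := (delta_mx 0 i : 'rV[R]_n.+1) (at level 8, i at level 2, format "''e_' i").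

Lemma homext_phi (f : sphere R n -> R) k :
  homext (phi f k) = fun y => expR (k%:R * homext f y) * homext (@h R n k) y.
Proof. by []. Qed.

Lemma sphere_Ck_phi j (f : sphere R n -> R) k : sphere_Ck j f -> sphere_Ck j (phi f k).
Proof.
move=> Cf; rewrite /sphere_Ck homext_phi; apply: CkM; last exact: smooth_h.
by apply: Ck_expR; exact: CkZ.
Qed.

Lemma lap_phi (f : sphere R n -> R) k (p : sphere R n) : (0 < n)%N -> sphere_Ck 2 f ->
  lap (homext (phi f k)) p = expR (k%:R * f p) *
    (- (k%:R * (k%:R + n%:R - 1)) * h k p
     + 2 * k%:R * (\sum_i 'D_('e_i) (homext f) p * 'D_('e_i) (homext (@h R n k)) p)
     + (k%:R * lap (homext f) p + k%:R ^+ 2 * \sum_i 'D_('e_i) (homext f) p ^+ 2) * h k p).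
Proof.
move=> n0 Cf; have p0 := sphere_neq0 p; have [df _] := Cf.
have Ce : Ck 2 (fun y => k%:R * homext f y) by exact: CkZ.
have Ch : Ck 2 (homext (@h R n k)) := @smooth_h R n k 2.
have := lapM (Ck_expR Ce) Ch p0.
have -> := lap_expR Ce p0.
have -> := lap_homext_h k p n0.
have -> := lapZ k%:R Cf p0.
rewrite (eq_bigr (fun i => expR (k%:R * homext f p) * k%:R *
    ('D_('e_i) (homext f) p * 'D_('e_i) (homext (@h R n k)) p))); last first.
  move=> i _; rewrite derive_expR; last by have [d _] := Ce; exact: d.
  rewrite deriveZR; last exact: df.
  by rewrite !mulrA.
have -> : \sum_(i < n.+1) 'D_('e_i) (fun y : E => k%:R * homext f y) p ^+ 2 =
    k%:R ^+ 2 * \sum_(i < n.+1) 'D_('e_i) (homext f) p ^+ 2.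
  rewrite mulr_sumr; apply: eq_bigr => i _.
  by rewrite deriveZR ?exprMn//; exact: df.
rewrite homext_phi -!mulr_sumr !homextE => ->.
by move: (lap _ _) (expR _) (\sum_i _) (\sum_i _) => a b c d; ring.
Qed.

Lemma grad_phi (f : sphere R n -> R) k (p : sphere R n) i : sphere_Ck 1 f ->
  grad (phi f k) p 0 i = expR (k%:R * f p) *
    ('D_('e_i) (homext (@h R n k)) p + k%:R * h k p * 'D_('e_i) (homext f) p).
Proof.
move=> [df _]; have p0 := sphere_neq0 p.
have [dh _] := smooth_h k 1 : Ck 1 (homext (@h R n k)).
have de : differentiable (fun y => k%:R * homext f y) (p : E).
  by apply: differentiableM; [exact: differentiable_cst|exact: df].
rewrite gradE homext_phi deriveMR; [|exact: (@differentiable_comp1 _ _ expR)|exact: dh].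
rewrite derive_expR// deriveZR; last exact: df.
by rewrite !homextE; move: ('D__ _ _) ('D__ _ _) => a b; ring.
Qed.

(** Since grad phi_k = e^(kf) (grad h_k + k h_k grad f), the first-order term 2k <grad f, grad
    phi_k> already contains 2 k^2 |grad f|^2 phi_k, whereas the Laplacian of e^(kf) only yields k^2
    |grad f|^2. This is why k^2 |grad f|^2 enters [Wk] with a minus sign. *)
Lemma laplacian_phi (f : sphere R n -> R) k (p : sphere R n) : (0 < n)%N ->
  sphere_Ck 2 f ->
  laplacian (phi f k) p = dot (Vk f k p) (grad (phi f k) p) + Wk f k p * phi f k p.
Proof.
move=> n0 Cf; have C1f := sphere_CkS Cf.
rewrite /Vk /Wk sqr_enorm !dotE.
rewrite (laplacianE p Cf) (laplacianE p (sphere_Ck_phi k Cf)).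
rewrite (lap_phi k p n0 Cf) /phi.
rewrite [X in _ = X + _](eq_bigr (fun i => 2 * k%:R * expR (k%:R * f p) *
     ('D_('e_i) (homext f) p * 'D_('e_i) (homext (@h R n k)) p)
   + 2 * k%:R ^+ 2 * expR (k%:R * f p) * h k p * 'D_('e_i) (homext f) p ^+ 2)); last first.
  move=> i _; rewrite mxE (grad_phi k p i C1f) gradE.
  by move: ('D__ _ _) ('D__ _ _) => a b; ring.
rewrite [X in _ - _ * X - _](eq_bigr (fun i => 'D_('e_i) (homext f) p ^+ 2)); last first.
  by move=> i _; rewrite gradE expr2.
rewrite big_split/= -!mulr_sumr.
by move: (lap _ _) (expR _) (\sum_i _) (\sum_i _) => a b c d; ring.
Qed.

End LaplacianPhi.

(** * Maximum points and the norms of the potentials *)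

Section SphereCompact.
Context {R : realType} {n : nat}.
Local Notation E := 'rV[R]_n.+1.
Local Notation "''e_' i" := (delta_mx 0 i : 'rV[R]_n.+1) (at level 8, i at level 2, format "''e_' i").
Implicit Types (x y v : E) (p q : sphere R n) (F : E -> R).

Lemma dot_coord_le (x : E) i : x 0 i ^+ 2 <= dot x x.
Proof.
rewrite dotE (bigD1 i)//= -expr2 lerDl; apply: sumr_ge0 => j _.
by rewrite -expr2 sqr_ge0.
Qed.

Lemma coord_le_enorm (x : E) i : `|x 0 i| <= enorm x.
Proof. by rewrite -sqrtr_sqr ler_wsqrtr// dot_coord_le. Qed.

Lemma norm_le_enorm (x : E) : `|x| <= enorm x.
Proof.
rewrite [leLHS]/Num.Def.normr/= mx_normrE; apply: bigmax_le; first exact: sqrtr_ge0.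
by move=> [i j] _ /=; rewrite ord1 coord_le_enorm.
Qed.

Lemma compact_unit_sphere : compact [set y : E | dot y y = 1].
Proof.
apply: bounded_closed_compact.
  exists 1; split; first exact: num_real.
  move=> M M1 x /= x1; apply: le_trans (norm_le_enorm x) _.
  by rewrite /enorm x1 sqrtr1 ltW.
rewrite (_ : [set y | _] = (fun y : E => dot y y) @^-1` [set 1])//.
apply: preimage_closed => [x _|]; last exact: closed_eq.
exact/differentiable_continuous/differentiable_dot.
Qed.

Lemma sphere_Ck_le j k (f : sphere R n -> R) : (j <= k)%N -> sphere_Ck k f -> sphere_Ck j f.
Proof. by move=> jk; exact: Ck_le. Qed.

(** The type [sphere] carries no topology here; compactness is used for the unit sphere as a subset
    of R^(n+1), and the maximum point is then packed into [sphere]. *)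
Lemma sphere_EVT F : (forall x, x != 0 -> {for x, continuous F}) ->
  exists p, forall q, F q <= F p.
Proof.
move=> cF.
have [||c cS cmax] := compact_EVT_max (_ : [set y : E | dot y y = 1] !=set0)
    compact_unit_sphere (_ : {within _, continuous F}).
- by exists (@north R n : E); exact: dot_sphere.
- apply: continuous_in_subspaceT => x; rewrite inE /= => x1; apply: cF.
  by rewrite -dot_eq0 x1 oner_eq0.
move: cS; rewrite inE/= => /eqP c1; exists (Sphere c1) => q.
by apply: cmax; rewrite inE /= dot_sphere.
Qed.

Lemma sphere_bounded F : (forall x, x != 0 -> {for x, continuous F}) ->
  exists2 M, 0 <= M & forall q, `|F q| <= M.
Proof.
move=> cF; have [|p pmax] := @sphere_EVT (fun y => `|F y|).
  move=> x x0; exact: (cvg_norm (cF x x0)).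
by exists `|F p|.
Qed.

Lemma sphere_C0_bounded (f : sphere R n -> R) : sphere_Ck 0 f ->
  exists2 M, 0 <= M & forall q, `|f q| <= M.
Proof.
move=> cf; have [M M0 H] := sphere_bounded cf; exists M => // q.
by have := H q; rewrite homextE.
Qed.

Lemma is_derive_line F x v (t : R) : differentiable F (x + t *: v) ->
  is_derive t 1 (fun s => F (x + s *: v)) ('D_v F (x + t *: v)).
Proof.
move=> dF.
have e : (fun h : R => h^-1 *: (((fun s => F (x + s *: v)) \o shift t) (h *: 1) - F (x + t *: v)))
  = (fun h => h^-1 *: ((F \o shift (x + t *: v)) (h *: v) - F (x + t *: v))).
  apply/funext => h /=; congr (_ *: (F _ - _)).
  by rewrite [h *: 1]mulr1 scalerDl addrCA.
by split; rewrite /derivable ?/derive e//; exact: diff_derivable.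
Qed.

Lemma homext_radialE (T : Type) (f : sphere R n -> T) y : homext f y = f (radial y).
Proof. by []. Qed.

Lemma near_line_neq0 p v : exists2 e : R, 0 < e &
  forall t, `|t| < e -> (p : E) + t *: v != 0.
Proof.
have [e /= e0 He] : \forall t \near (0 : R), (p : E) + t *: v != 0.
  have cv : (p : E) + t *: v @[t --> (0 : R)] --> (p : E).
    rewrite -[X in _ --> X]addr0 -(scale0r v).
    by apply: cvgD; [exact: cvg_cst|apply: cvgZr_tmp; exact: cvg_id].
  exact: cv _ (near_neq0 (sphere_neq0 p)).
by exists e => // t te; apply: He; rewrite /= sub0r normrN.
Qed.

(** The extension takes only values of f, so a maximum point on the sphere is a maximum point of the
    extension on the whole space. Straight lines through p can thus replace curves on the sphere. *)
Lemma derive_at_max (f : sphere R n -> R) p v : sphere_Ck 1 f ->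
  (forall q, f q <= f p) -> 'D_v (homext f) p = 0.
Proof.
move=> [df _] pmax; have [e e0 He] := near_line_neq0 p v; set F := homext f.
have line (t : R) : `|t| < e -> is_derive t 1 (fun s => F ((p : E) + s *: v)) ('D_v F ((p : E) + t *: v)).
  by move=> te; apply: is_derive_line; apply: df; exact: He.
have [] := @derive1_at_max R (fun s => F ((p : E) + s *: v)) (- e) e 0.
- by rewrite ge0_cp// ltW.
- move=> t; rewrite in_itv/= -ltr_norml => te.
  by have [] := line _ te.
- by rewrite in_itv/= oppr_lt0 e0.
- by move=> t _; rewrite scale0r addr0 /F homextE; exact: pmax.
move=> _ <-; have [|_ ->] := line 0; first by rewrite normr0.
by rewrite scale0r addr0.
Qed.

(** Were the second derivative positive, D_v would be positive just after p on the line p + t v,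
    because it vanishes at p; the mean value theorem would then give a value larger than the
    maximum. *)
Lemma derive2_at_max (f : sphere R n -> R) p v : sphere_Ck 2 f ->
  (forall q, f q <= f p) -> 'D_v ('D_v (homext f)) p <= 0.
Proof.
move=> Cf pmax; rewrite leNgt; apply/negP => a0.
have g0 := derive_at_max v (sphere_CkS Cf) pmax.
have [df d2] := Cf; have [d2f _] := d2 v; set F := homext f in g0 *.
have p0 := sphere_neq0 p.
have Fp y : F y <= F p by rewrite /F homextE; exact: pmax.
have [e e0 He] := near_line_neq0 p v.
have line (t : R) : `|t| < e -> is_derive t 1 (fun s => F ((p : E) + s *: v)) ('D_v F ((p : E) + t *: v)).
  by move=> te; apply: is_derive_line; apply: df; exact: He.
have : \forall h \near 0^', 0 < h^-1 *: (('D_v F \o shift (p : E)) (h *: v) - 'D_v F p).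
  apply: (@cvgr_gt _ _ _ _ _ ('D_v ('D_v F) p)) => //.
  exact: (@diff_derivable _ _ _ _ _ v (d2f _ p0)).
move=> [e' /= e'0 He'].
pose d := Num.min e e' / 2.
have m0 : 0 < Num.min e e' by rewrite lt_min e0.
have d0 : 0 < d by rewrite divr_gt0.
have dm : d < Num.min e e' by rewrite ltr_pdivrMr// ltr_pMr// ltr1n.
have de : d < e by rewrite (lt_le_trans dm)// ge_min lexx.
have de' : d < e' by rewrite (lt_le_trans dm)// ge_min lexx orbT.
have dl t : 0 <= t <= d -> `|t| < e.
  by move=> /andP[t0 td]; rewrite ger0_norm// (le_lt_trans td).
have [||c cd] := @MVT R (fun s => F ((p : E) + s *: v)) (fun t => 'D_v F ((p : E) + t *: v)) 0 d d0.
- move=> t; rewrite in_itv/= => /andP[t0 td]; apply: line.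
  by apply: dl; rewrite !ltW.
- apply: continuous_in_subspaceT => t; rewrite inE/= in_itv/= => td.
  by apply/differentiable_continuous/derivable1_diffP; have [] := line t (dl _ td).
move: cd; rewrite in_itv/= => /andP[c0 cd].
rewrite scale0r addr0 subr0 => Hc.
suff : 0 < F ((p : E) + d *: v) - F p by rewrite subr_gt0 ltNge Fp.
rewrite Hc mulr_gt0//.
have := He' c; rewrite /= sub0r normrN gtr0_norm// => /(_ (lt_trans cd de')).
rewrite gt_eqF// => /(_ isT); rewrite g0 subr0 [c *: v + _]addrC.
by rewrite pmulr_rgt0// invr_gt0.
Qed.

Lemma laplacian_at_max (f : sphere R n -> R) p : sphere_Ck 2 f ->
  (forall q, f q <= f p) -> grad f p = 0 /\ laplacian f p <= 0.
Proof.
move=> Cf pmax; split.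
  by apply/rowP => i; rewrite gradE mxE derive_at_max//; exact: sphere_CkS Cf.
by rewrite laplacianE//; apply: sumr_le0 => i _; exact: derive2_at_max.
Qed.

(** If the segment met 0, then (1 - t) p = - t q; comparing norms gives 1 - t = t, and q = - p
    follows. *)
Lemma sphere_segment p q (t : R) : (q : E) != - (p : E) -> 0 <= t <= 1 ->
  (p : E) + t *: ((q : E) - (p : E)) != 0.
Proof.
move=> qp /andP[t0 t1]; apply/negP => /eqP H.
have {}H : (1 - t) *: (p : E) = - (t *: (q : E)).
  apply/eqP; rewrite -addr_eq0 -{}H scalerBl scale1r scalerBr -!addrA.
  by apply/eqP; congr (_ + _); rewrite addrC.
have := congr1 (fun z : E => enorm z) H; rewrite -scalerN.
have eN : enorm (- (q : E)) = 1 by rewrite -scaleN1r /enorm dotZ sqrrN expr1n mul1r dot_sphere sqrtr1.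
rewrite !enormZ ?subr_ge0// eN enorm_sphere !mulr1 => tt.
move: H; rewrite tt -scalerN => /eqP; rewrite -subr_eq0 -scalerBr scaler_eq0.
have /gt_eqF -> : 0 < t by lra.
by rewrite opprK addrC addr_eq0 (negPf qp).
Qed.

(* A segment between two non-antipodal points avoids the origin; antipodal points
   are compared through a third one. *)
Lemma grad0_const (f : sphere R n -> R) : (0 < n)%N -> sphere_Ck 1 f ->
  (forall p, grad f p = 0) -> forall p q, f p = f q.
Proof.
move=> n0 Cf g0; have [df _] := Cf.
have D0 y v : y != 0 -> 'D_v (homext f) y = 0.
  move=> y0; rewrite derive_coords; last exact: df.
  rewrite big1// => i _.
  have := homext_grad i Cf y0; rewrite homext_radialE g0 mxE => /esym/eqP.
  by rewrite mulf_eq0 gt_eqF ?enorm_gt0//= => /eqP ->; rewrite scaler0.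
have main p q : (q : E) != - (p : E) -> f p = f q.
  move=> qp; pose v := (q : E) - (p : E).
  have line (t : R) : 0 <= t <= 1 -> is_derive t 1 (fun s => homext f ((p : E) + s *: v)) 0.
    move=> t01; have s0 := sphere_segment qp t01.
    by rewrite -(D0 _ v s0); apply: is_derive_line; exact: df.
  have [||c _] := @MVT R (fun s => homext f ((p : E) + s *: v)) (fun=> 0) 0 1 ltr01.
  - by move=> t; rewrite in_itv/= => /andP[t0 t1]; apply: line; rewrite !ltW.
  - apply: continuous_in_subspaceT => t; rewrite inE/= in_itv/= => td.
    by apply/differentiable_continuous/derivable1_diffP; have [] := line t td.
  rewrite scale1r scale0r addr0 /v [(p : E) + _]addrC subrK mul0r !homextE => /eqP.
  by rewrite subr_eq0 => /eqP.
move=> p q; have [qp|] := eqVneq (q : E) (- (p : E)); last exact: main.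
(* The third point is the first basis vector or, if that one is p or - p, the last: then p has last
   coordinate 0, because n > 0 makes the two basis vectors distinct. *)
have [r rp rq] : exists2 r : sphere R n, (r : E) != - (p : E) & (r : E) != (p : E).
  have deltaS (i : 'I_n.+1) : @dot R 1 n.+1 'e_i 'e_i == 1.
    by rewrite dot_delta mxE !eqxx.
  have [/andP[h1 h2]|] := boolP (('e_ord0 != - (p : E)) && ('e_ord0 != (p : E))).
    by exists (Sphere (deltaS ord0)).
  rewrite negb_and !negbK => h.
  have p1 : (p : E) 0 ord_max = 0.
    by case/orP: h => /eqP/(congr1 (fun z : E => z 0 ord_max));
      rewrite !mxE eqxx -val_eqE/= gtn_eqF// => /esym/eqP; rewrite ?oppr_eq0 => /eqP.
  exists (Sphere (deltaS ord_max)); apply/eqP => /(congr1 (fun z : E => z 0 ord_max));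
    by rewrite /= !mxE !eqxx p1 ?oppr0 => /eqP; rewrite oner_eq0.
rewrite (main _ _ rp); apply: main; rewrite qp eqr_opp.
by rewrite eq_sym.
Qed.

End SphereCompact.

Section NormBounds.
Context {R : realType} {n : nat}.
Local Notation E := 'rV[R]_n.+1.
Local Notation "''e_' i" := (delta_mx 0 i : 'rV[R]_n.+1) (at level 8, i at level 2, format "''e_' i").
Implicit Types (p q : sphere R n).

Lemma supnorm_le (f : sphere R n -> R) M : (forall p, `|f p| <= M) -> (supnorm f <= M%:E)%E.
Proof.
by move=> fM; apply: ge_ereal_sup => _ [p _ <-]; rewrite lee_fin.
Qed.

Lemma le_supnorm (f : sphere R n -> R) p : (`|f p|%:E <= supnorm f)%E.
Proof. by apply: ereal_sup_ubound; exists p. Qed.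

Lemma supnorm_ge0 (f : sphere R n -> R) : (0 <= supnorm f)%E.
Proof. by apply: le_trans (le_supnorm f north); rewrite lee_fin. Qed.

Lemma enorm_le_sum m1 m2 (A : 'M[R]_(m1, m2)) : enorm A <= \sum_i \sum_j `|A i j|.
Proof.
set S := \sum_i _; have S0 : 0 <= S by do 2 (apply: sumr_ge0 => ? _).
rewrite -[S]ger0_norm// -sqrtr_sqr ler_wsqrtr// expr2 /dot {1}/S mulr_suml.
apply: ler_sum => i _; rewrite mulr_suml; apply: ler_sum => j _.
rewrite -expr2 -real_normK ?num_real// expr2 ler_wpM2l//.
rewrite /S (bigD1 i)//= (bigD1 j)//= -addrA lerDl addr_ge0//.
  exact: sumr_ge0.
by do 2 (apply: sumr_ge0 => ? _).
Qed.

Lemma grad_bounded (f : sphere R n -> R) i : sphere_Ck 1 f ->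
  exists2 M, 0 <= M & forall p, `|grad f p 0 i| <= M.
Proof. by move=> Cf; apply: sphere_C0_bounded; exact: sphere_Ck_grad. Qed.

Lemma uniform_grad_bounded (f : sphere R n -> R) : sphere_Ck 1 f ->
  exists2 M, 0 <= M & forall p i, `|grad f p 0 i| <= M.
Proof.
move=> Cf; have /choice[M HM] i : exists M, 0 <= M /\ forall p, `|grad f p 0 i| <= M.
  by have [M M0 H] := grad_bounded i Cf; exists M.
exists (\sum_i M i); first by apply: sumr_ge0 => i _; exact: (HM i).1.
move=> p i; apply: le_trans ((HM i).2 p) _; rewrite (bigD1 i)//= lerDl.
by apply: sumr_ge0 => j _; exact: (HM j).1.
Qed.

Lemma enorm_rV_le (v : E) M : (forall i, `|v 0 i| <= M) -> enorm v <= n.+1%:R * M.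
Proof.
move=> vM; apply: le_trans (enorm_le_sum v) _; rewrite big_ord1.
apply: (@le_trans _ _ (\sum_(i < n.+1) M)); first exact: ler_sum.
by rewrite sumr_const card_ord mulr_natl.
Qed.

Lemma homextZl (c : R) (V : sphere R n -> E) :
  homext (fun p => c *: V p) = fun y => c *: homext V y.
Proof. by []. Qed.

Lemma covZ (c : R) (V : sphere R n -> E) p : differentiable (homext V) (p : E) ->
  cov (fun q => c *: V q) p = c *: cov V p.
Proof.
move=> dV; rewrite /cov scalemxAl; congr (_ *m _); apply/matrixP => i j.
have dc : differentiable (homext (fun q => c *: V q)) (p : E).
  by rewrite homextZl; exact: differentiableZ.
rewrite jacobianE// [RHS]mxE jacobianE//.
rewrite (_ : (fun z : E => homext (fun q => c *: V q) z 0 j) = fun z => c * homext V z 0 j); last first.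
  by apply/funext => z; rewrite homextZl mxE.
rewrite deriveZR//.
apply: (@differentiable_comp _ _ _ _ (homext V) (fun y : E => y 0 j)) => //.
exact: differentiable_coord_rV.
Qed.

Lemma cov_grad_bounded (f : sphere R n -> R) : sphere_Ck 2 f ->
  exists2 M, 0 <= M & forall p, enorm (cov (grad f) p) <= M.
Proof.
move=> Cf.
have dG p : differentiable (homext (grad f)) (p : E).
  apply: differentiable_homext_row => i.
  by have [d _] := sphere_Ck_grad i Cf; apply: d; exact: sphere_neq0.
have /choice[M HM] (ij : 'I_n.+1 * 'I_n.+1) : exists M, 0 <= M /\
    forall p, `|'J (homext (grad f)) p ij.1 ij.2| <= M.
  have [d1 d2] := sphere_Ck_grad ij.2 Cf.
  have [M M0 H] := sphere_bounded (d2 'e_(ij.1)).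
  by exists M; split => // p; rewrite jacobianE//; exact: H.
pose S := \sum_ij M ij.
have MS ij : M ij <= S.
  by rewrite /S (bigD1 ij)//= lerDl; apply: sumr_ge0 => k _; exact: (HM k).1.
have S0 : 0 <= S by apply: sumr_ge0 => k _; exact: (HM k).1.
(* Each entry of the Jacobian is at most S, and each entry of the projection 1 - x^T x is at most 1
   + 1 in absolute value. *)
exists (\sum_(i < n.+1) \sum_(j < n.+1) \sum_(k < n.+1) S * 2).
  by do 3 (apply: sumr_ge0 => ? _); rewrite mulr_ge0.
move=> p; apply: le_trans (enorm_le_sum _) _.
apply: ler_sum => i _; apply: ler_sum => j _; rewrite mxE.
apply: le_trans (ler_norm_sum _ _ _) _; apply: ler_sum => k _.
rewrite normrM ler_pM//; first exact: le_trans ((HM (i, k)).2 p) (MS _).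
have c1 l : `|(p : E) 0 l| <= 1 by rewrite -(enorm_sphere p) coord_le_enorm.
rewrite !mxE big_ord1 !mxE; apply: le_trans (ler_normB _ _) _.
rewrite -[2]/(1 + 1) lerD//; first by case: (_ == _); rewrite ?normr1 ?normr0.
by rewrite normrM -[1]mulr1 ler_pM.
Qed.

(** [Vk] is 2k times a fixed field, so both constants are independent of k. The lower one is read
    off at a point where the gradient is nonzero; such a point exists because a function with zero
    gradient is constant. *)
Lemma Vk_norm_bounds (f : sphere R n -> R) : (0 < n)%N -> sphere_Ck 2 f ->
  (exists x y, f x <> f y) ->
  exists a b, [/\ 0 < a, 0 <= b & forall k,
    ((a * k%:R)%:E <= C1norm_field (Vk f k) <= (b * k%:R)%:E)%E].
Proof.
move=> n0 Cf fnc; have C1f := sphere_CkS Cf.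
have [p0 gp0] : exists p, grad f p != 0.
  apply: contrapT => /forallNP H; case: fnc => x [y]; apply.
  by apply: grad0_const => // p; have /negP := H p; rewrite negbK => /eqP.
have [M1 M10 HM1] := uniform_grad_bounded C1f.
have [M2 M20 HM2] := cov_grad_bounded Cf.
exists (2 * enorm (grad f p0)), (2 * (n.+1%:R * M1 + M2)); split.
- by rewrite mulr_gt0// enorm_gt0.
- by rewrite mulr_ge0// addr_ge0// mulr_ge0.
move=> k; have k0 : 0 <= 2 * k%:R :> R by rewrite mulr_ge0.
have dG p : differentiable (homext (grad f)) (p : E).
  apply: differentiable_homext_row => i.
  by have [d _] := sphere_Ck_grad i Cf; apply: d; exact: sphere_neq0.
apply/andP; split.
  rewrite /C1norm_field -[leLHS]adde0; apply: leeD; last exact: supnorm_ge0.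
  apply: le_trans (le_supnorm _ p0); rewrite lee_fin /Vk enormZ//.
  by rewrite ger0_norm ?mulr_ge0// ?sqrtr_ge0// mulrAC.
rewrite (_ : _ * k%:R = 2 * k%:R * (n.+1%:R * M1) + 2 * k%:R * M2); last by ring.
rewrite EFinD; apply: leeD; apply: supnorm_le => p.
  rewrite ger0_norm ?sqrtr_ge0// /Vk enormZ// ler_wpM2l//.
  by apply: enorm_rV_le => i; exact: HM1.
rewrite ger0_norm ?sqrtr_ge0// /Vk covZ// /enorm dotZ sqrtrM ?sqr_ge0//.
by rewrite sqrtr_sqr ger0_norm// ler_wpM2l//; exact: HM2.
Qed.

(** The maximum point of f is the same for all k, and there no cancellation can occur between the
    three terms of W_k. The third derivatives of f enter through the gradient of its Laplacian. *)
Lemma Wk_norm_bounds (f : sphere R n -> R) : (0 < n)%N -> sphere_Ck 3 f ->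
  exists2 b, 0 <= b & forall k, (1 <= k)%N ->
    ((k%:R ^+ 2)%:E <= C1norm (Wk f k) <= (b * k%:R ^+ 2)%:E)%E.
Proof.
move=> n0 Cf; have C2f : sphere_Ck 2 f by exact: Ck_le Cf.
have C1f := sphere_CkS Cf.
pose A := laplacian f; pose B p := enorm (grad f p) ^+ 2.
have CA : sphere_Ck 1 A by exact: sphere_Ck_laplacian.
have CB : sphere_Ck 1 B.
  apply: (@eq_Ck _ _ _ _ (fun y => \sum_i homext (fun p => grad f p 0 i) y * homext (fun p => grad f p 0 i) y)).
    by move=> y y0; rewrite /homext /B /= sqr_enorm dotE.
  by apply: Ck_sum => i; apply: CkM; exact: (sphere_Ck_grad i C2f).
have [MA MA0 HA] := sphere_C0_bounded (sphere_Ck_le (leq0n _) CA).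
have [MB MB0 HB] := sphere_C0_bounded (sphere_Ck_le (leq0n _) CB).
have [GA GA0 HGA] := uniform_grad_bounded CA.
have [GB GB0 HGB] := uniform_grad_bounded CB.
(* For k >= 1 one has k <= k^2 and k (k + n - 1) <= n k^2; the factor n + 1 turns coordinatewise
   bounds of the gradient into a bound of its Euclidean norm. *)
exists (MA + MB + n%:R + n.+1%:R * (GA + GB)).
  by rewrite !addr_ge0// mulr_ge0// addr_ge0.
move=> k k1; have k1R : 1 <= k%:R :> R by rewrite ler1n.
have k0R : 0 <= k%:R :> R by [].
have kk : k%:R <= k%:R ^+ 2 :> R by rewrite expr2 ler_peMl.
have n1R : 1 <= n%:R :> R by rewrite ler1n.
apply/andP; split.
  have [p pmax] := sphere_EVT (fun x x0 => @Ck_continuous _ _ _ _ _ x Cf x0).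
  have {}pmax q : f q <= f p by have := pmax q; rewrite !homextE.
  have [g0 l0] := laplacian_at_max C2f pmax.
  rewrite /C1norm -[leLHS]adde0; apply: leeD; last exact: supnorm_ge0.
  apply: le_trans (le_supnorm _ p); rewrite lee_fin -normrN.
  apply: le_trans (ler_norm _).
  rewrite /Wk g0 enorm0 expr0n/= mulr0 subr0 opprB.
  have : k%:R * laplacian f p <= 0 by rewrite mulr_ge0_le0.
  have : 0 <= k%:R * (n%:R - 1) :> R by rewrite mulr_ge0// subr_ge0.
  by nra.
rewrite mulrDl EFinD; apply: leeD; apply: supnorm_le => p.
  have hA := HA p; have hB := HB p.
  rewrite /Wk -/(A p) -/(B p).
  apply: le_trans (ler_normB _ _) _; rewrite [leRHS]mulrDl; apply: lerD; last first.
    rewrite ger0_norm; last by rewrite mulr_ge0// -addrA addr_ge0// subr_ge0.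
    by nra.
  apply: le_trans (ler_normB _ _) _; rewrite [leRHS]mulrDl; apply: lerD.
    by rewrite normrM ger0_norm// mulrC ler_pM.
  by rewrite normrM ger0_norm ?exprn_ge0// mulrC ler_wpM2r ?exprn_ge0.
rewrite ger0_norm ?sqrtr_ge0// -mulrA; apply: enorm_rV_le => i.
have [dA _] := CA; have [dB _] := CB; have s0 := sphere_neq0 p.
have -> : grad (Wk f k) p 0 i = k%:R * grad A p 0 i - k%:R ^+ 2 * grad B p 0 i.
  rewrite !gradE.
  rewrite (_ : homext (Wk f k) = fun y => k%:R * homext A y + (- k%:R ^+ 2 * homext B y
     + - (k%:R * (k%:R + n%:R - 1)))); last first.
    by apply/funext => y; rewrite /homext /Wk/= -/(A _) -/(B _); ring.
  have [d1 d2] := (dA _ s0, dB _ s0).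
  rewrite deriveDR; last 2 first.
  - by apply: differentiableM => //; exact: differentiable_cst.
  - apply: differentiableD; last exact: differentiable_cst.
    by apply: differentiableM => //; exact: differentiable_cst.
  rewrite deriveDR; last 2 first.
  - by apply: differentiableM => //; exact: differentiable_cst.
  - exact: differentiable_cst.
  by rewrite !deriveZR// (derive_cst (- _)) addr0 mulNr.
apply: le_trans (ler_normB _ _) _; rewrite mulrDl; apply: lerD.
  by rewrite normrM ger0_norm// mulrC ler_pM.
by rewrite normrM ger0_norm ?exprn_ge0// mulrC ler_wpM2r ?exprn_ge0.
Qed.

Lemma potential_norm_bounds (f : sphere R n -> R) : (0 < n)%N -> sphere_Ck 3 f ->
  (exists x y, f x <> f y) ->
  exists2 C : R, 0 < C & forall k : nat, (1 <= k)%N ->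
    ((C^-1 * k%:R)%:E <= C1norm_field (Vk f k) <= (C * k%:R)%:E)%E /\
    ((C^-1 * k%:R ^+ 2)%:E <= C1norm (Wk f k) <= (C * k%:R ^+ 2)%:E)%E.
Proof.
move=> n0 Cf fnc.
have [a [b [a0 b0 HV]]] := Vk_norm_bounds n0 (sphere_Ck_le (leqnSn 2) Cf) fnc.
have [c c0 HW] := Wk_norm_bounds n0 Cf.
have ai0 : 0 < a^-1 by rewrite invr_gt0.
pose C := 1 + a^-1 + b + c.
have C0 : 0 < C by rewrite /C; lra.
exists C => // k k1; have k0R : 0 <= k%:R :> R by [].
have Ca : C^-1 <= a by rewrite -[a]invrK lef_pV2 ?posrE// /C; lra.
have C1 : C^-1 <= 1 by rewrite invf_le1// /C; lra.
have bC : b <= C by rewrite /C; lra.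
have cC : c <= C by rewrite /C; lra.
have /andP[V1 V2] := HV k; have /andP[W1 W2] := HW k k1.
split; apply/andP; split.
- by apply: le_trans V1; rewrite lee_fin ler_wpM2r.
- by apply: le_trans V2 _; rewrite lee_fin ler_wpM2r.
- by apply: le_trans W1; rewrite lee_fin ler_piMl// exprn_ge0.
- by apply: le_trans W2 _; rewrite lee_fin ler_wpM2r// exprn_ge0.
Qed.

End NormBounds.

(** * Boxes and integration on the sphere *)

Section BoxMeasure.
Context {R : realType}.
Local Notation mR := (measurableTypeR R).
Local Notation E m := 'rV[R]_m.

Definition box m (a b : 'I_m -> R) : set (m.-tuple mR) :=
  [set t | forall i, a i <= tnth t i <= b i].

Lemma measurable_forall_tnth m (A : 'I_m -> set mR) : (forall i, measurable (A i)) ->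
  measurable [set t : m.-tuple mR | forall i, A i (tnth t i)].
Proof.
move=> mA; rewrite (_ : [set t | _] = \bigcap_(i in setT) ((@tnth _ mR ^~ i) @^-1` A i)).
  apply: fin_bigcap_measurable => // i _.
  rewrite -[X in measurable X]setTI; exact: measurable_tnth.
by apply/seteqP; split => t /= H i; [move=> _|]; exact: H.
Qed.

Lemma measurable_box m (a b : 'I_m -> R) : measurable (box a b).
Proof.
rewrite (_ : box a b = [set t : m.-tuple mR | forall i, `[a i, b i]%classic (tnth t i)]).
  by apply: (@measurable_forall_tnth m (fun i => `[a i, b i]%classic)) => i; exact: measurable_itv.
by apply/seteqP; split => t /= H i; have := H i; rewrite /= in_itv.
Qed.

Lemma lebesgue_tuple_box m (a b : 'I_m -> R) : (forall i, a i <= b i) ->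
  lebesgue_tuple m (box a b) = (\prod_i (b i - a i))%:E.
Proof.
elim: m a b => [|m IH] a b ab.
  rewrite big_ord0 /= diracE mem_set//=.
  by move=> [].
rewrite big_ord_recl /= /lebesgue_step /pushforward.
rewrite (_ : _ @^-1` _ = `[a ord0, b ord0]%classic `*`
    box (fun i => a (lift ord0 i)) (fun i => b (lift ord0 i))); last first.
  apply/seteqP; split => -[x t] /=.
    move=> H; split; first by have := H ord0; rewrite /= in_itv.
    by move=> i; have := H (lift ord0 i); rewrite tnthS.
  rewrite in_itv /= => -[H1 H2] i.
  have [->//|i0] := eqVneq i ord0.
  case: (unliftP ord0 i) i0 => [j ->|->]; last by rewrite eqxx.
  by rewrite tnthS => _; exact: H2.
rewrite product_measure1E//; last exact: measurable_box.
rewrite IH//; have := lebesgue_measure_itv `[a ord0, b ord0].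
rewrite /= lte_fin => Hl; rewrite [X in (X * _)%E]Hl.
have := ab ord0; rewrite le_eqVlt => /orP[/eqP ->|->//].
by rewrite ltxx mul0e subrr mul0r.
Qed.

End BoxMeasure.

(** * Open sets and continuous functions as measurable objects on tuples *)

Section RowMeasurability.
Context {R : realType}.
Local Notation mR := (measurableTypeR R).

Lemma row_of_tupleK m (x : 'rV[R]_m) : row_of_tuple (tuple_of_row x) = x.
Proof. by apply/rowP => i; rewrite mxE tnth_mktuple. Qed.

(** The sigma-algebra on tuples is generated by the coordinates, while openness refers to the
    topology of row vectors. The two are reconciled by writing an open set as the countable union of
    the rational open cubes that it contains. *)
Lemma measurable_open_row m (U : set 'rV[R]_m) : open U ->
  measurable [set t : m.-tuple mR | U (row_of_tuple t)].
Proof.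
move=> oU.
pose B (qe : 'rV[rat]_m * rat) : set (m.-tuple mR) :=
  [set t | forall i, `]ratr (qe.1 0 i) - ratr qe.2, ratr (qe.1 0 i) + ratr qe.2[%classic (tnth t i)].
pose F qe := if `[< B qe `<=` [set t | U (row_of_tuple t)] >] then B qe else set0.
have -> : [set t | U (row_of_tuple t)] = \bigcup_qe F qe.
  apply/seteqP; split => [t Ut|t [qe _]]; last first.
    by rewrite /F; case: asboolP => // H; exact: H.
  have [e /= e0 He] : nbhs_ball (row_of_tuple t) U.
    by rewrite nbhs_ballE; exact: oU.
  (* The rational centre is only within e' of t, so a point of the cube is within 2 e' of t; hence
     e' < e / 2. *)
  have [e' e'e] : exists e' : rat, (ratr e' : R) \in `]0, e / 2[.
    have [|q qe] := @rat_in_itvoo R 0 (e / 2); last by exists q.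
    by rewrite divr_gt0.
  move: e'e; rewrite in_itv/= => /andP[e'0 e'e].
  have /choice[q Hq] (i : 'I_m) : exists q : rat,
      (ratr q : R) \in `]tnth t i - ratr e', tnth t i + ratr e'[.
    have [|q qe] := @rat_in_itvoo R (tnth t i - ratr e') (tnth t i + ratr e'); last by exists q.
    by rewrite ltrBlDr -addrA ltrDl addr_gt0.
  have Bt : B (\row_i q i, e') t.
    by move=> i; have := Hq i; rewrite /= !in_itv/= mxE; lra.
  exists (\row_i q i, e') => //; rewrite /F; case: asboolP => //; case => s Bs.
  apply: He; rewrite /ball/=; split => // i j; rewrite /ball/= ord1 !mxE.
  have := Hq j; have := Bs j; rewrite /= !in_itv/= mxE ltr_norml.
  by lra.
apply: countable_bigcupT_measurable; first exact: countableP.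
move=> qe; rewrite /F; case: asboolP => // _.
apply: (@measurable_forall_tnth _ m (fun i => `]ratr (qe.1 0 i) - ratr qe.2,
  ratr (qe.1 0 i) + ratr qe.2[%classic)) => i; exact: measurable_itv.
Qed.

Lemma measurable_row_continuous m (U : set 'rV[R]_m) (F : 'rV[R]_m -> R) : open U ->
  (forall x, U x -> {for x, continuous F}) ->
  measurable_fun [set t : m.-tuple mR | U (row_of_tuple t)] (F \o @row_of_tuple R _).
Proof.
move=> oU cF; apply: (measurability _ (RGenOInfty.measurableE R)).
move=> /= _ [_ [a ->]] <-.
rewrite (_ : _ `&` _ = [set t | (U `&` F @^-1` `]a, +oo[%classic) (row_of_tuple t)]); last first.
  by apply/seteqP; split => t [].
apply: measurable_open_row; rewrite openE => x [Ux Fx].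
apply: filterI; first exact: oU.
by apply: (cF x Ux); apply: open_nbhs_nbhs; split => //; exact: interval_open.
Qed.

End RowMeasurability.

Lemma ge0_integral_mrestr d (T : measurableType d) (R : realType)
    (mu : {measure set T -> \bar R}) (D : set T) (mD : measurable D) (f : T -> \bar R) :
  measurable_fun setT f -> (forall x, 0 <= f x)%E ->
  (\int[mrestr mu mD]_x f x = \int[mu]_(x in D) f x)%E.
Proof.
move=> mf f0; rewrite [LHS](@ge0_negligible_integral _ _ _ _ _ (~` D))//.
- rewrite setTD setCK; apply: eq_measure_integral => A mA AP.
  by rewrite /= /mrestr setIidl.
- exact: measurableC.
- by rewrite /= /mrestr setICl measure0.
Qed.

Lemma ge0_integral_pushforward_restr d1 d2 (X : measurableType d1)
    (Y : measurableType d2) (R : realType) (mu : {measure set X -> \bar R})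
    (D : set X) (mD : measurable D) (k : {nonneg R}) (g : X -> Y)
    (f : Y -> \bar R) :
  measurable_fun setT g -> measurable_fun setT f -> (forall x, 0 <= f x)%E ->
  (\int[pushforward (mscale k (mrestr mu mD)) g]_y f y =
   k%:num%:E * \int[mu]_(x in D) f (g x))%E.
Proof.
move=> mg mf f0; have mfg : measurable_fun setT (f \o g) by exact: measurableT_comp.
rewrite [LHS](ge0_integral_pushforward mg)//.
rewrite preimage_setT [LHS](ge0_integral_mscale _ measurableT)//.
  by rewrite (ge0_integral_mrestr mu mD mfg (fun x => f0 (g x))).
by move=> x _; exact: f0.
Qed.

Section SphereMeasure.
Context {R : realType} {n : nat}.
Local Notation mR := (measurableTypeR R).
Local Notation E := 'rV[R]_n.+1.
Implicit Types (p : sphere R n).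

Lemma row_coords p : row_of_tuple (sphere_coords p) = p.
Proof. exact: row_of_tupleK. Qed.

Lemma open_neq0 : open [set y : E | y != 0].
Proof. by rewrite openE => x x0; exact: near_neq0. Qed.

Lemma measurable_offzero (F : E -> R) : (forall x, x != 0 -> {for x, continuous F}) ->
  measurable_fun [set t : n.+1.-tuple mR | row_of_tuple t != 0] (F \o @row_of_tuple R _).
Proof. by move=> cF; apply: (measurable_row_continuous open_neq0). Qed.

Lemma measurable_neq0 : measurable [set t : n.+1.-tuple mR | row_of_tuple t != 0].
Proof. exact: (measurable_open_row open_neq0). Qed.

(** For the trace sigma-algebra a preimage under f must be cut out by a measurable set of R^(n+1):
    the preimage under the extension, restricted to y <> 0 where the extension is continuous. *)
Lemma measurable_sphere_Ck (f : sphere R n -> R) : sphere_Ck 0 f -> measurable_fun setT f.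
Proof.
move=> cf _ Y mY; rewrite setTI.
exists ([set t | row_of_tuple t != 0] `&` (homext f \o @row_of_tuple R _) @^-1` Y).
  exact: (measurable_offzero cf measurable_neq0).
rewrite setTI; apply/seteqP; split => p /=; rewrite row_coords homextE; first by case.
by split => //; exact: sphere_neq0.
Qed.

Lemma sphere_volE (A : set (sphere R n)) : sphere_vol R n A =
  (n.+1%:R%:E * lebesgue_tuple n.+1 ((@radial_tuple R n) @^-1` A `&` punctured_ball))%E.
Proof. by []. Qed.

Lemma ge0_integral_sphere (F : sphere R n -> \bar R) : measurable_fun setT F ->
  (forall p, 0 <= F p)%E ->
  (\int[sphere_vol R n]_p F p = n.+1%:R%:E *
    \int[lebesgue_tuple n.+1]_(t in punctured_ball) F (radial_tuple t))%E.
Proof.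
move=> mF F0.
exact: (ge0_integral_pushforward_restr _ measurable_punctured_ball
  n.+1%:R%:nng measurable_radial_tuple mF F0).
Qed.

End SphereMeasure.

(** * Vanishing order at the pole *)

Lemma ler_of_eq {R : realType} (x y : R) : x = y -> x <= y.
Proof. by move=> ->. Qed.

Section LimsupAtRight.
Context {R : realType}.
Local Open Scope ereal_scope.

Lemma limf_esup_right_le (g : R -> \bar R) (M : \bar R) :
  (\forall r \near (0%R : R)^'+, g r <= M) -> limf_esup g 0^'+ <= M.
Proof.
move=> gM; apply: le_trans (_ : ereal_sup (g @` [set r | g r <= M]) <= M).
  by apply: ereal_inf_lbound; exists [set r | g r <= M].
by apply: ge_ereal_sup => _ [r /= rM <-].
Qed.

Lemma le_limf_esup_right (g : R -> \bar R) (M : \bar R) :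
  (\forall r \near (0%R : R)^'+, M <= g r) -> M <= limf_esup g 0^'+.
Proof.
move=> gM; apply: le_ereal_inf_tmp => _ [V FV <-].
have /filter_ex[r [Vr Mr]] : \forall r \near (0%R : R)^'+, V r /\ M <= g r.
  exact: filterI.
by apply: le_trans Mr _; apply: ereal_sup_ubound; exists r.
Qed.

End LimsupAtRight.

Section TrigBounds.
Context {R : realType}.

Lemma sin_le (x : R) : 0 <= x -> sin x <= x.
Proof.
rewrite le_eqVlt => /orP[/eqP <-|x0]; first by rewrite sin0.
have [|c _] := @MVT R sin cos 0 x x0.
  by apply: continuous_subspaceT => y; exact: continuous_sin.
by rewrite sin0 !subr0 => ->; rewrite ler_piMl ?cos_le1// ltW.
Qed.

Lemma half_le_sin : \forall x \near (0 : R)^'+, x / 2 <= sin x.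
Proof.
have : \forall x \near (0 : R), 2^-1 < cos x.
  have := @continuous_cos R 0; rewrite /continuous_at cos0 => /cvgr_gt; apply.
  by rewrite invf_lt1// ltr1n.
move=> [d /= d0 Hd]; exists d => // x + x0.
rewrite /= sub0r normrN => xd.
have [|c] := @MVT R sin cos 0 x x0.
  by apply: continuous_subspaceT => y; exact: continuous_sin.
rewrite in_itv/= => /andP[c0 cx]; rewrite sin0 !subr0 => ->.
rewrite mulrC ler_wpM2r// ?ltW//; apply: Hd.
by rewrite /= sub0r normrN gtr0_norm// (lt_trans cx)// (le_lt_trans (ler_norm x)).
Qed.

Lemma acos_lt (c r : R) : -1 <= c <= 1 -> 0 <= r <= pi -> (acos c < r) = (cos r < c).
Proof.
move=> c1 r1; rewrite -{2}(acosK c1) ltr_cos// in_itv/= ?acos_ge0// ?acos_lepi//.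
Qed.

End TrigBounds.

(** * Polar caps and their volume *)

Section GeodesicBalls.
Context {R : realType} {n : nat}.
Local Notation mR := (measurableTypeR R).
Local Notation E := 'rV[R]_n.+1.
Implicit Types (p : sphere R n).

Lemma sphere_Ck_coord k i : sphere_Ck k (fun p => (p : E) 0 i).
Proof.
apply: (@eq_Ck _ _ _ _ (fun y => y 0 i * (enorm y)^-1)).
  by move=> y y0; rewrite /homext /= radialE// mxE mulrC.
by apply: CkM; [exact: Ck_coord|exact: Ck_invenorm].
Qed.

Lemma sphere_coord_le1 p i : -1 <= (p : E) 0 i <= 1.
Proof. by rewrite -ler_norml -(enorm_sphere p) coord_le_enorm. Qed.

Lemma dot_north p : dot (@north R n : E) p = (p : E) 0 ord_max.
Proof.
rewrite /= dotE (bigD1 ord_max)//= mxE !eqxx mul1r big1 ?addr0// => i iN.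
by rewrite mxE (negPf iN) andbF mul0r.
Qed.

Lemma geodesic_ballE (r : R) : 0 <= r <= pi ->
  geodesic_ball (@north R n) r = [set p | cos r < (p : E) 0 ord_max].
Proof.
move=> r0; apply/seteqP; split => p; rewrite /geodesic_ball/= dot_north acos_lt//;
  exact: sphere_coord_le1.
Qed.

Lemma measurable_superlevel (f : sphere R n -> R) (a : R) : sphere_Ck 0 f ->
  measurable [set p | a < f p].
Proof.
move=> /measurable_sphere_Ck /(_ measurableT `]a, +oo[%classic (measurable_itv _)).
rewrite setTI; congr measurable; apply/seteqP; split => p /=; by rewrite in_itv/= andbT.
Qed.

Lemma measurable_geodesic_ball (r : R) : 0 <= r <= pi ->
  measurable (geodesic_ball (@north R n) r).
Proof.
by move=> r0; rewrite geodesic_ballE//; apply: measurable_superlevel; exact: sphere_Ck_coord.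
Qed.

Lemma dot_split_max (y : E) :
  dot y y = y 0 ord_max ^+ 2 + \sum_(i < n.+1 | i != ord_max) y 0 i ^+ 2.
Proof.
by rewrite dotE (bigD1 ord_max)//= -expr2; congr (_ + _); apply: eq_bigr => i _; rewrite expr2.
Qed.

(** At polar angle a the coordinates other than the last satisfy x_i^2 <= 1 - x_max^2 = sin(a)^2,
    and sin a <= a < r. *)
Lemma coord_geodesic_ball (r : R) p i : i != ord_max -> geodesic_ball north r p ->
  `|(p : E) 0 i| <= r.
Proof.
rewrite /geodesic_ball/= dot_north => iN pr.
have c1 := sphere_coord_le1 p ord_max.
apply: le_trans (ltW pr); apply: le_trans (sin_le (acos_ge0 c1)).
have e := dot_sphere p; rewrite dot_split_max in e.
rewrite sin_acos// -sqrtr_sqr ler_wsqrtr// -[X in X - _]e addrC addKr.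
by rewrite (bigD1 i)//= lerDl sumr_ge0// => j _; rewrite sqr_ge0.
Qed.

(* In the cone over the ball of radius r around the pole all coordinates but
   the last are bounded by r. *)
Lemma sphere_vol_ball_le (r : R) : 0 <= r <= pi ->
  (sphere_vol R n (geodesic_ball north r) <= (n.+1%:R * (2 * (2 * r) ^+ n))%:E)%E.
Proof.
move=> r0; have [r0' _] := andP r0.
rewrite sphere_volE EFinM lee_wpmul2l ?lee_fin//.
pose a (i : 'I_n.+1) := if i == ord_max then 1 else r.
have a0 i : 0 <= a i by rewrite /a; case: ifP.
have -> : 2 * (2 * r) ^+ n = \prod_i (a i - - a i).
  rewrite (bigD1 ord_max)//= {1}/a {1}/a eqxx opprK; congr (_ * _).
  rewrite (eq_bigr (fun=> 2 * r)) => [|i iN]; last by rewrite /a (negPf iN) opprK mulr2n mulrDl mul1r.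
  by rewrite (eq_bigl (mem (predC1 ord_max)))// prodr_const cardC1 card_ord.
rewrite -lebesgue_tuple_box; last by move=> i; rewrite ge0_cp.
apply: le_measure; rewrite ?inE.
- apply: measurableI; last exact: measurable_punctured_ball.
  by rewrite -[X in measurable X]setTI; apply: measurable_radial_tuple => //; exact: measurable_geodesic_ball.
- exact: measurable_box.
move=> t [/= tr /andP[t0 t1]] i; rewrite -ler_norml.
have y0 : row_of_tuple t != 0.
  by apply: contraTneq t0 => ->; rewrite enorm0 ltxx.
have ti : tnth t i = (row_of_tuple t) 0 i by rewrite mxE.
rewrite /a ti; case: ifPn => iN; first exact: le_trans (coord_le_enorm _ _) t1.
(* Projecting a point of the unit ball to the sphere divides by a norm at most 1, so the bound for
   the projected coordinate passes to the original one. *)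
have := coord_geodesic_ball iN tr; apply: le_trans.
rewrite /radial_tuple radialE// [leRHS](_ : _ = (enorm (row_of_tuple t))^-1 * `|(row_of_tuple t) 0 i|).
  by rewrite ler_peMl// invf_ge1.
by rewrite mxE normrM ger0_norm// invr_ge0 ltW.
Qed.

End GeodesicBalls.

(** * Mass of phi_k on small balls *)

Section VanishingOrder.
Context {R : realType} {n : nat}.
Local Notation mR := (measurableTypeR R).
Local Notation E := 'rV[R]_n.+1.
Implicit Types (p : sphere R n).

Definition ball_mass (u : sphere R n -> R) (r : R) : \bar R :=
  (\int[sphere_vol R n]_(x in geodesic_ball north r) (`|u x| ^+ 2)%:E)%E.

Lemma ball_mass_ge0 u r : (0 <= ball_mass u r)%E.
Proof. by apply: integral_ge0 => x _; rewrite lee_fin exprn_ge0. Qed.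

(** With mass C r^(2k+n) the normalized root is sqrt C r^k. For d = k the quotient stays above sqrt
    c, so k belongs to the set, which contains positive d only; for 0 < d < k it is at most sqrt K
    r^(k-d), which tends to 0. The infimum is therefore attained at k. *)
Lemma vanishing_orderE (u : sphere R n -> R) (k : nat) (K c : R) : (1 <= k)%N ->
  0 < c -> 0 < K ->
  (\forall r \near (0 : R)^'+, (ball_mass u r <= (K * r ^+ (k.*2 + n))%:E)%E) ->
  (\forall r \near (0 : R)^'+, ((c * r ^+ (k.*2 + n))%:E <= ball_mass u r)%E) ->
  vanishing_order u north = (k%:R : R)%:E.
Proof.
move=> k1 c0 K0 HK Hc; rewrite /vanishing_order.
have scaled (C r : R) : 0 < r -> 0 < C ->
    poweR (((r ^+ n)^-1)%:E * (C * r ^+ (k.*2 + n))%:E)%E 2^-1 = (Num.sqrt C * r `^ k%:R)%:E.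
  move=> r0 C0; rewrite -EFinM poweR_EFin powR12_sqrt; last first.
    by rewrite !mulr_ge0// ?invr_ge0 ?exprn_ge0// ltW.
  have -> : r ^- n * (C * r ^+ (k.*2 + n)) = C * r ^+ k.*2.
    by rewrite exprD mulrCA [_^-1 * _]mulrC mulfK// gt_eqF// exprn_gt0.
  rewrite sqrtrM ?ltW// -muln2 exprM sqrtr_sqr ger0_norm ?exprn_ge0 ?ltW//.
  by rewrite powR_mulrn// ltW.
have inset (r : R) (x : \bar R) : (0 <= x)%E -> x \in `[0%E, +oo%E].
  by move=> x0; rewrite in_itv/= x0 leey.
apply/eqP; rewrite eq_le; apply/andP; split.
  apply: ereal_inf_lbound; exists k%:R => //; split; first by rewrite ltr0n.
  apply: (@lt_le_trans _ _ (Num.sqrt c)%:E); first by rewrite lte_fin sqrtr_gt0.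
  apply: le_limf_esup_right; near=> r.
  have r0 : 0 < r by near: r; exact: nbhs_right_gt.
  have -> : (Num.sqrt c)%:E = (((r `^ k%:R)^-1)%:E *
      poweR (((r ^+ n)^-1)%:E * (c * r ^+ (k.*2 + n))%:E) 2^-1)%E.
    by rewrite scaled// -EFinM mulrCA mulVf ?mulr1// gt_eqF// powR_gt0.
  apply: lee_wpmul2l; first by rewrite lee_fin invr_ge0 powR_ge0.
  have rn : (0 <= ((r ^+ n)^-1)%:E)%E by rewrite lee_fin invr_ge0 exprn_ge0// ltW.
  apply: gt0_ler_poweR; rewrite ?invr_ge0//.
  - by apply: inset => //; rewrite mule_ge0// lee_fin mulr_ge0 ?exprn_ge0// ltW.
  - by apply: inset => //; rewrite mule_ge0// ball_mass_ge0.
  by apply: lee_wpmul2l => //; near: r.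
apply: le_ereal_inf_tmp => _ [d [d0 dpos] <-]; rewrite lee_fin leNgt; apply/negP => dk.
move: dpos; apply/negP; rewrite -leNgt.
apply/lee_addgt0Pr => e e0; rewrite add0e.
apply: limf_esup_right_le.
have sK : 0 < Num.sqrt K by rewrite sqrtr_gt0.
have kd : 0 < k%:R - d by rewrite subr_gt0.
have He : \forall r \near (0 : R)^'+, Num.sqrt K * r `^ (k%:R - d) <= e.
  have /cvgrPdist_le := powR_cvg0 kd.
  move=> /(_ (e / Num.sqrt K)); rewrite divr_gt0// => /(_ isT).
  apply: filterS => r; rewrite sub0r normrN ger0_norm ?powR_ge0//.
  by rewrite ler_pdivlMr// mulrC.
near=> r.
have r0 : 0 < r by near: r; exact: nbhs_right_gt.
apply: (@le_trans _ _ (((r `^ d)^-1)%:E *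
      poweR (((r ^+ n)^-1)%:E * (K * r ^+ (k.*2 + n))%:E) 2^-1)%E).
  apply: lee_wpmul2l; first by rewrite lee_fin invr_ge0 powR_ge0.
  have rn : (0 <= ((r ^+ n)^-1)%:E)%E by rewrite lee_fin invr_ge0 exprn_ge0// ltW.
  apply: gt0_ler_poweR; rewrite ?invr_ge0//.
  - by apply: inset => //; rewrite mule_ge0// ball_mass_ge0.
  - by apply: inset => //; rewrite mule_ge0// lee_fin mulr_ge0 ?exprn_ge0// ltW.
  by apply: lee_wpmul2l => //; near: r.
rewrite scaled// -EFinM lee_fin mulrCA [_^-1 * _]mulrC -powRB; last first.
  by rewrite gt_eqF.
by near: r.
Unshelve. all: by end_near. Qed.

(** The l^1 norm of (x_1, x_2), rather than the modulus, lets both coupled recursions be closed by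
    the triangle inequality; it is the source of the 2 in (2 r)^k. *)
Lemma hre_him_le k (y : E) :
  `|hre k y| <= (`|y 0 ord0| + `|y 0 (inord 1)|) ^+ k /\
  `|him k y| <= (`|y 0 ord0| + `|y 0 (inord 1)|) ^+ k.
Proof.
elim: k => [|k [IH1 IH2]]; first by rewrite hre0 him0 expr0 normr1 normr0.
rewrite hreS himS exprS mulrDl; split.
- by apply: le_trans (ler_normB _ _) _; rewrite !normrM lerD// ler_wpM2l.
- by apply: le_trans (ler_normD _ _) _; rewrite !normrM lerD// ler_wpM2l.
Qed.

Lemma eq_hre_him k (y z : E) : y 0 ord0 = z 0 ord0 -> y 0 (inord 1) = z 0 (inord 1) ->
  hre k y = hre k z.
Proof. by rewrite /hre => -> ->. Qed.

(** With n >= 2 neither x_1 nor x_2 is the last coordinate, so both are at most r on the ball around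
    the pole. *)
Lemma phi_ball_le (f : sphere R n -> R) k (r M : R) p : (2 <= n)%N ->
  (forall q, `|f q| <= M) -> geodesic_ball north r p ->
  `|phi f k p| ^+ 2 <= (expR (k%:R * M) * (2 * r) ^+ k) ^+ 2.
Proof.
move=> n2 fM pr; rewrite lerXn2r// ?nnegrE//.
  by rewrite mulr_ge0 ?expR_ge0 ?exprn_ge0// mulr_ge0//;
    apply: le_trans (coord_geodesic_ball (_ : ord0 != ord_max) pr) => //;
    rewrite -val_eqE/= ltn_eqF// ltnW.
rewrite normrM ger0_norm ?expR_ge0// ler_pM ?expR_ge0//.
  by rewrite ler_expR ler_wpM2l// (le_trans (ler_norm _)).
rewrite -/(hre k _); apply: le_trans (hre_him_le k p).1 _.
rewrite lerXn2r// ?nnegrE ?addr_ge0//.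
  by rewrite mulr_ge0//; apply: le_trans (coord_geodesic_ball (_ : ord0 != ord_max) pr) => //;
    rewrite -val_eqE/= ltn_eqF// ltnW.
rewrite mulr2n mulrDl mul1r lerD//; apply: coord_geodesic_ball pr.
  by rewrite -val_eqE/= ltn_eqF// ltnW.
by rewrite -val_eqE/= inordK ?ltn_eqF// ltnW.
Qed.

Lemma hre_him_delta0 k : (0 < n)%N ->
  hre k (delta_mx 0 ord0 : E) = 1 /\ him k (delta_mx 0 ord0 : E) = 0.
Proof.
move=> n0; have i10 : inord 1 != ord0 :> 'I_n.+1 by rewrite -val_eqE/= inordK.
elim: k => [|k [IH1 IH2]]; first by rewrite hre0 him0.
rewrite hreS himS IH1 IH2 !mxE !eqxx (negPf i10) /=.
by split; ring.
Qed.

(** Continuity at e_1. The bound s <= 1/2 later keeps the first n coordinates of the box below 2 rho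
    in absolute value. *)
Lemma hre_near_delta0 k : (0 < n)%N -> exists s : R, [/\ 0 < s, s <= 2^-1 &
  forall w : E, (forall i, `|w 0 i - (i == ord0)%:R| <= s) -> 2^-1 <= hre k w].
Proof.
move=> n0; have := differentiable_continuous (differentiable_hre_him k (delta_mx 0 ord0 : E)).1.
rewrite /prop_for /continuous_at (hre_him_delta0 k n0).1 => /cvgr_gt /(_ 2^-1).
rewrite invf_lt1// ltr1n => /(_ isT) /nbhs_ballP[e /= e0 He].
have m0 : 0 < Num.min (e / 2) 2^-1 :> R by rewrite lt_min divr_gt0//= invr_gt0.
exists (Num.min (e / 2) 2^-1); split => //; first by rewrite ge_min lexx orbT.
move=> w Hw; apply/ltW/He; rewrite -ball_normE/=.
apply: (@le_lt_trans _ _ (e / 2)); last by rewrite ltr_pdivrMr// ltr_pMr// ltr1n.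
rewrite [leLHS]/Num.Def.normr/= mx_normrE; apply: bigmax_le; first by rewrite divr_ge0// ltW.
move=> [i j] _ /=; rewrite ord1 !mxE eqxx/= distrC.
by apply: le_trans (Hw j) _; rewrite ge_min lexx.
Qed.

(* The first n coordinates of the box, divided by rho, range over an
   s-neighbourhood of e_1, a point at which Re (x_1 + i x_2)^k = 1. *)
Definition lo_bound (rho s : R) (i : 'I_n.+1) : R :=
  if i == ord_max then 2^-1 else rho * ((i == ord0)%:R - s).
Definition hi_bound (rho s : R) (i : 'I_n.+1) : R :=
  if i == ord_max then 3 / 4 else rho * ((i == ord0)%:R + s).

Lemma prod_bounds (rho s : R) :
  \prod_i (hi_bound rho s i - lo_bound rho s i) = 4^-1 * (2 * rho * s) ^+ n.
Proof.
rewrite (bigD1 ord_max)//= /hi_bound /lo_bound eqxx; congr (_ * _); first by lra.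
rewrite (eq_bigr (fun=> 2 * rho * s)) => [|i iN]; last by rewrite (negPf iN); ring.
by rewrite (eq_bigl (mem (predC1 ord_max)))// prodr_const cardC1 card_ord.
Qed.

(** Let S be the sum of the squares of the first n coordinates. The constant 16 n gives S <= n (2
    rho)^2 <= r^2 / 64, while the last coordinate lies in [1/2, 3/4]; hence |y| <= 1 and the
    direction of y stays in the cap. On the box (x_1 + i x_2)^k has real part at least rho^k / 2;
    the 4 in the conclusion makes the inequality strict. *)
Lemma box_in_cone (k : nat) (r s : R) : (2 <= n)%N -> 0 < r -> r <= 1 -> r / 2 <= sin r ->
  0 < s -> s <= 2^-1 ->
  (forall w : E, (forall i, `|w 0 i - (i == ord0)%:R| <= s) -> 2^-1 <= hre k w) ->
  let rho := (16 * n%:R)^-1 * r in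
  box (lo_bound rho s) (hi_bound rho s) `<=`
  (@radial_tuple R n) @^-1` [set p : sphere R n | cos r < (p : E) 0 ord_max /\ rho ^+ k / 4 < h k p]
    `&` punctured_ball.
Proof.
move=> n2 r0 r1 sinr s0 s1 Hs rho t Ht.
have n0 : (0 < n)%N by exact: ltnW.
have n0R : 1 <= n%:R :> R by rewrite ler1n.
pose tau : R := (16 * n%:R)^-1.
have tau0 : 0 < tau by rewrite invr_gt0 mulr_gt0// (lt_le_trans ltr01).
have ntau : n%:R * tau = 16^-1 by rewrite /tau invfM mulrCA mulfV ?mulr1// gt_eqF// (lt_le_trans ltr01).
have tau1 : tau <= 16^-1 by rewrite -ntau ler_peMl// ltW.
have rhoE : rho = tau * r by [].
have rho0 : 0 < rho by rewrite mulr_gt0.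
set y := row_of_tuple t.
have yE i : y 0 i = tnth t i by rewrite mxE.
have ymax : 2^-1 <= y 0 ord_max <= 3 / 4.
  by have := Ht ord_max; rewrite /lo_bound /hi_bound eqxx yE.
have yother i : i != ord_max -> rho * ((i == ord0)%:R - s) <= y 0 i <= rho * ((i == ord0)%:R + s).
  by move=> iN; have := Ht i; rewrite /lo_bound /hi_bound (negPf iN) yE.
have yle i : i != ord_max -> y 0 i ^+ 2 <= (2 * rho) ^+ 2.
  move=> iN; have /andP[h1 h2] := yother i iN.
  have rho20 : 0 <= 2 * rho by rewrite mulr_ge0// ltW.
  rewrite -real_normK ?num_real// lerXn2r// ?nnegrE//.
  rewrite ler_norml; move: h1 h2; case: (i == ord0) => /= h1 h2; apply/andP; split; nra.
pose S := \sum_(i < n.+1 | i != ord_max) y 0 i ^+ 2.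
have S0 : 0 <= S by apply: sumr_ge0 => i _; rewrite sqr_ge0.
have S1 : S <= n%:R * (2 * rho) ^+ 2.
  apply: le_trans (_ : \sum_(i < n.+1 | i != ord_max) (2 * rho) ^+ 2 <= _).
    by apply: ler_sum => i; exact: yle.
  apply: ler_of_eq.
  by rewrite (eq_bigl (mem (predC1 ord_max)))// sumr_const cardC1 card_ord -[LHS]mulr_natl.
have S2 : S <= 4^-1 * tau * r ^+ 2.
  apply: le_trans S1 _; rewrite rhoE [leLHS](_ : _ = 4 * (n%:R * tau) * tau * r ^+ 2); last by ring.
  by rewrite ntau; apply: ler_of_eq; field.
have dotyE : dot y y = y 0 ord_max ^+ 2 + S by exact: dot_split_max.
have r2 : r ^+ 2 <= 1 by rewrite expr_le1// ltW.
have S3 : S <= 64^-1 * r ^+ 2.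
  apply: le_trans S2 _; rewrite ler_wpM2r ?sqr_ge0//; lra.
have doty1 : dot y y <= 1 by rewrite dotyE; nra.
have doty0 : 0 < dot y y by rewrite dotyE; nra.
have y0 : y != 0 by rewrite -dot_eq0 gt_eqF.
have ey0 := enorm_gt0 y0.
have ey1 : enorm y <= 1 by rewrite -sqrtr1 ler_wsqrtr.
split; last by rewrite /punctured_ball/= -/y ey0 ey1.
rewrite /= /radial_tuple -/y; split.
(* Outside the cap, the last coordinate c of the projection satisfies c^2 <= 1 - sin(r)^2 <= 1 - r^2
   / 4. Multiplying by |y|^2 forces S >= r^2 / 16, against S <= r^2 / 64. *)
- rewrite ltNge; apply/negP; rewrite radialE// mxE => H.
  set c := _ * _ in H.
  have c0 : 0 <= c by rewrite mulr_ge0 ?invr_ge0 ?ltW//; lra.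
  have cE : dot y y * c ^+ 2 = y 0 ord_max ^+ 2.
    by rewrite /c exprMn exprVn sqr_enorm mulVKf ?gt_eqF.
  have : c ^+ 2 <= cos r ^+ 2 by rewrite lerXn2r// nnegrE// (le_trans c0).
  have : (r / 2) ^+ 2 <= sin r ^+ 2.
    have r20 : 0 <= r / 2 by rewrite divr_ge0// ltW.
    by rewrite lerXn2r// nnegrE// (le_trans r20).
  rewrite sin2cos2 => h1 h2.
  have h3 : c ^+ 2 <= 1 - r ^+ 2 / 4 by lra.
  have h4 : y 0 ord_max ^+ 2 <= dot y y * (1 - r ^+ 2 / 4) by rewrite -cE ler_wpM2l// ltW.
  have h5 : 4^-1 <= y 0 ord_max ^+ 2 by nra.
  have r20 : 0 < r ^+ 2 by rewrite exprn_gt0.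
  by rewrite dotyE in h4; nra.
- have := homext_h k y0; rewrite homext_radialE => ->.
  (* The last coordinate of w may be set to 0 because the polynomial only sees x_1 and x_2; this
     places all of w near e_1. *)
  pose w : E := \row_i (if i == ord_max then 0 else rho^-1 * y 0 i).
  have hw : 2^-1 <= hre k w.
    apply: Hs => i; rewrite mxE; case: ifPn => iN.
      by rewrite (eqP iN) -val_eqE/= gtn_eqF//= subrr normr0 ltW.
    have /andP[h1 h2] := yother i iN.
    have h3 : (i == ord0)%:R - s <= rho^-1 * y 0 i by rewrite ler_pdivlMl.
    have h4 : rho^-1 * y 0 i <= (i == ord0)%:R + s by rewrite ler_pdivrMl.
    by rewrite ler_norml; apply/andP; split; lra.
  have m0 : ord_max != ord0 :> 'I_n.+1 by rewrite -val_eqE/= gtn_eqF.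
  have m1 : ord_max != inord 1 :> 'I_n.+1 by rewrite -val_eqE/= inordK ?gtn_eqF// ltnW.
  have hy : hre k y = rho ^+ k * hre k w.
    rewrite -(hre_himZ k rho w).1; apply: eq_hre_him.
      by rewrite !mxE eq_sym (negPf m0) mulVKf// gt_eqF.
    by rewrite !mxE eq_sym (negPf m1) mulVKf// gt_eqF.
  have rk0 : 0 < rho ^+ k by rewrite exprn_gt0.
  have hy2 : rho ^+ k / 2 <= hre k y by rewrite hy ler_wpM2l// ltW.
  apply: (@lt_le_trans _ _ (hre k y)); first by apply: lt_le_trans hy2; lra.
  (* Since |y| <= 1, the factor |y|^-k only increases the positive value. *)
  rewrite ler_peMr//; first by apply: le_trans hy2; rewrite divr_ge0// ltW.
  by rewrite exprn_ege1// invf_ge1.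
Qed.

Lemma phi_ball_mass_ge (f : sphere R n -> R) k (M : R) : (2 <= n)%N ->
  sphere_Ck 0 f -> (forall q, `|f q| <= M) ->
  exists2 c : R, 0 < c & \forall r \near (0 : R)^'+,
    ((c * r ^+ (k.*2 + n))%:E <= ball_mass (phi f k) r)%E.
Proof.
move=> n2 Cf fM; have n0 : (0 < n)%N by exact: ltnW.
have n0R : 0 < n%:R :> R by rewrite ltr0n.
have [s [s0 s1 Hs]] := hre_near_delta0 k n0.
pose tau : R := (16 * n%:R)^-1.
have tau0 : 0 < tau by rewrite invr_gt0 mulr_gt0.
(* On the good part of the ball |phi_k| >= e^(-kM) rho^k / 4 with rho = tau r, that is, at least a
   r^k. *)
pose a : R := expR (- (k%:R * M)) * (tau ^+ k / 4).
have a0 : 0 < a by rewrite mulr_gt0 ?expR_gt0// divr_gt0// exprn_gt0.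
exists (a ^+ 2 * (n.+1%:R * (4^-1 * (2 * tau * s) ^+ n))).
  by rewrite mulr_gt0 ?exprn_gt0// mulr_gt0// mulr_gt0 ?exprn_gt0// !mulr_gt0.
near=> r.
have r0 : 0 < r by near: r; exact: nbhs_right_gt.
have r1 : r <= 1 by near: r; exact: nbhs_right_le.
have sinr : r / 2 <= sin r by near: r; exact: half_le_sin.
have rpi : 0 <= r <= pi by rewrite ltW//= (le_trans r1)// (le_trans _ (pi_ge2 R))// ler1n.
pose rho := tau * r; have rho0 : 0 < rho by rewrite mulr_gt0.
pose A := [set p : sphere R n | cos r < (p : E) 0 ord_max] `&` [set p | rho ^+ k / 4 < h k p].
have mA : measurable A.
  apply: measurableI; apply: measurable_superlevel; first exact: sphere_Ck_coord.
  exact: smooth_h.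
have mphi : measurable_fun setT (fun x => (`|phi f k x| ^+ 2)%:E).
  apply/measurable_EFinP; apply: measurable_funX; apply: measurableT_comp => //.
  by apply: measurable_sphere_Ck; exact: sphere_Ck_phi.
have mB : measurable (geodesic_ball (@north R n) r) by exact: measurable_geodesic_ball.
apply: (@le_trans _ _ (\int[sphere_vol R n]_(x in A) (`|phi f k x| ^+ 2)%:E)%E); last first.
  apply: ge0_subset_integral => //.
  - exact: measurable_funTS.
  - by move=> p [Ap _]; rewrite geodesic_ballE.
apply: (@le_trans _ _ (\int[sphere_vol R n]_(x in A) (cst (((a * r ^+ k) ^+ 2)%:E) x))%E); last first.
  apply: ge0_le_integral => //.
  - by move=> x _; rewrite lee_fin exprn_ge0// mulr_ge0 ?exprn_ge0// ltW.
  - exact: measurable_funTS.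
  move=> p [_ hp]; rewrite lee_fin.
  have ark0 : 0 <= a * r ^+ k by rewrite mulr_ge0 ?exprn_ge0// ltW.
  rewrite lerXn2r// ?nnegrE// normrM [`|expR _|]ger0_norm ?expR_ge0// /a -mulrA ler_pM ?expR_ge0//.
  - by rewrite mulr_ge0 ?exprn_ge0 ?divr_ge0 ?exprn_ge0 ?ltW.
  - rewrite ler_expR -mulrN ler_wpM2l//.
    by have := fM p; rewrite ler_norml => /andP[].
  - apply: le_trans (ler_norm _); apply: le_trans (ltW hp).
    by rewrite /rho exprMn mulrAC.
rewrite integral_cst//.
have volA : ((n.+1%:R * (4^-1 * (2 * rho * s) ^+ n))%:E <= sphere_vol R n A)%E.
  rewrite sphere_volE EFinM lee_wpmul2l ?lee_fin//.
  rewrite -prod_bounds -lebesgue_tuple_box; last first.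
    move=> i; rewrite /lo_bound /hi_bound; case: ifP => _; first by lra.
    by rewrite ler_wpM2l ?ltW//; lra.
  apply: le_measure; rewrite ?inE.
  - exact: measurable_box.
  - apply: measurableI; last exact: measurable_punctured_ball.
    by rewrite -[X in measurable X]setTI; apply: measurable_radial_tuple.
  - exact: box_in_cone.
apply: (@le_trans _ _ (((a * r ^+ k) ^+ 2)%:E * (n.+1%:R * (4^-1 * (2 * rho * s) ^+ n))%:E)%E).
  rewrite -EFinM lee_fin exprD -muln2 exprM /rho.
  rewrite (_ : 2 * (tau * r) * s = (2 * tau * s) * r); last by ring.
  rewrite [((2 * tau * s) * r) ^+ n]exprMn [(a * r ^+ k) ^+ 2]exprMn; apply: ler_of_eq.
  by move: ((_ * s) ^+ n) (r ^+ k) (r ^+ n) => x1 x2 x3; ring.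
by apply: lee_wpmul2l => //; rewrite lee_fin sqr_ge0.
Unshelve. all: by end_near. Qed.

Lemma phi_ball_mass_le (f : sphere R n -> R) k (M : R) : (2 <= n)%N ->
  sphere_Ck 0 f -> (forall q, `|f q| <= M) ->
  exists2 K : R, 0 < K & \forall r \near (0 : R)^'+,
    (ball_mass (phi f k) r <= (K * r ^+ (k.*2 + n))%:E)%E.
Proof.
move=> n2 Cf fM.
exists ((expR (k%:R * M) * 2 ^+ k) ^+ 2 * (n.+1%:R * (2 * 2 ^+ n))).
  by rewrite mulr_gt0// ?exprn_gt0 ?mulr_gt0 ?expR_gt0 ?exprn_gt0.
near=> r.
have r0 : 0 < r by near: r; exact: nbhs_right_gt.
have r1 : r <= 1 by near: r; exact: nbhs_right_le.
have rpi : 0 <= r <= pi by rewrite ltW//= (le_trans r1)// (le_trans _ (pi_ge2 R))// ler1n.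
have mB : measurable (geodesic_ball (@north R n) r) by exact: measurable_geodesic_ball.
have mphi : measurable_fun setT (fun x => (`|phi f k x| ^+ 2)%:E).
  apply/measurable_EFinP; apply: measurable_funX; apply: measurableT_comp => //.
  by apply: measurable_sphere_Ck; exact: sphere_Ck_phi.
set L := (expR (k%:R * M) * (2 * r) ^+ k) ^+ 2.
apply: (@le_trans _ _ (\int[sphere_vol R n]_(x in geodesic_ball north r) (cst L%:E x))%E).
  apply: ge0_le_integral => //.
  - exact: measurable_funTS.
  - by move=> x Bx; rewrite lee_fin; exact: phi_ball_le Bx.
rewrite integral_cst//.
apply: (@le_trans _ _ (L%:E * (n.+1%:R * (2 * (2 * r) ^+ n))%:E)%E).
  by apply: lee_wpmul2l; [rewrite lee_fin sqr_ge0|exact: sphere_vol_ball_le].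
rewrite -EFinM lee_fin exprD -muln2 exprM /L.
rewrite ![(2 * r) ^+ _]exprMn; apply: ler_of_eq.
by move: (expR _) (2 ^+ k) (2 ^+ n) (r ^+ k) (r ^+ n) => x1 x2 x3 x4 x5; ring.
Unshelve. all: by end_near. Qed.

Lemma vanishing_order_phi (f : sphere R n -> R) k : (2 <= n)%N -> (1 <= k)%N ->
  sphere_Ck 0 f -> vanishing_order (phi f k) north = (k%:R : R)%:E.
Proof.
move=> n2 k1 Cf; have [M _ fM] := sphere_C0_bounded Cf.
have [K K0 HK] := phi_ball_mass_le k n2 Cf fM.
have [c c0 Hc] := phi_ball_mass_ge k n2 Cf fM.
exact: (vanishing_orderE k1 c0 K0 HK Hc).
Qed.

End VanishingOrder.

(** * Green's formula on the sphere *)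

Section PartialDerivativeIntegral.
Context {R : realType}.
Local Notation mR := (measurableTypeR R).

Lemma measurable_cons_tuple_l m (x : mR) :
  measurable_fun setT (fun t : m.-tuple mR => Defs.cons_tuple (x, t)).
Proof. by apply: measurable_cons => //; exact: measurable_id. Qed.

Lemma integrable_box_supported m (g : m.-tuple mR -> R) (B M : R) : 0 <= B ->
  measurable_fun setT g -> (forall t, `|g t| <= M) ->
  (forall t, ~ box (fun=> - B) (fun=> B) t -> g t = 0) ->
  (lebesgue_tuple m).-integrable setT (EFin \o g).
Proof.
move=> B0 mg gM g0.
have mB : measurable (box (fun=> - B) (fun=> B) : set (m.-tuple mR)) by exact: measurable_box.
have lB : (lebesgue_tuple m (box (fun=> (- B)%R) (fun=> B)) < +oo)%E.
  by rewrite lebesgue_tuple_box ?ltry// => _; rewrite ge0_cp.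
rewrite (_ : EFin \o g = (EFin \o g) \_ (box (fun=> - B) (fun=> B))).
  apply/(integrable_mkcond _ mB).1/(measurable_bounded_integrable mB lB (measurable_funTS mg)).
  exists M; split; first exact: num_real.
  by move=> N MN t _ /=; apply: le_trans (gM t) _; exact: ltW.
apply/funext => t; rewrite patchE; case: ifPn => // /negP tB /=.
by rewrite g0// => /mem_set.
Qed.

Lemma integral_derivative_compact (G g : R -> R) (B : R) : 0 <= B ->
  (forall s : R, is_derive s 1 G (g s)) -> continuous g ->
  (forall s, B < `|s| -> G s = 0) -> (forall s, B < `|s| -> g s = 0) ->
  (\int[@lebesgue_measure R]_s (g s)%:E = 0)%E.
Proof.
move=> B0 dG cg G0 g0.
(* The primitive is only known to vanish for |s| > B, so the interval is enlarged to have endpoints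
   strictly outside. *)
have lt0 : - (B + 1) < B + 1 by lra.
transitivity (\int[@lebesgue_measure R]_(s in `[(- (B + 1))%R, (B + 1)%R]) (g s)%:E)%E.
  rewrite [RHS]integral_mkcond; apply: eq_integral => s _; rewrite patchE.
  case: ifPn => // /negP sB; rewrite g0// ltNge; apply/negP => sB'.
  by apply: sB; rewrite inE/= in_itv/= -ler_norml; lra.
have cG : continuous G.
  by move=> s; apply/differentiable_continuous/derivable1_diffP; have [] := dG s.
rewrite (@continuous_FTC2 _ g G)//.
- rewrite !G0 ?subee// ?normrN ger0_norm; lra.
- exact: continuous_subspaceT.
- split; first by move=> s _; have [] := dG s.
  + exact: cvg_at_right_filter (cG _).
  + exact: cvg_at_left_filter (cG _).
- by move=> s _; rewrite derive1E; have [_ ->] := dG s.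
Qed.

Definition upd m (t : m.-tuple mR) (i : 'I_m) (s : R) : m.-tuple mR :=
  [tuple if j == i then s else tnth t j | j < m].

Lemma upd_cons0 m (x s : R) (t : m.-tuple mR) :
  upd (Defs.cons_tuple (x, t)) ord0 s = Defs.cons_tuple (s, t).
Proof.
apply: eq_from_tnth => j; rewrite tnth_mktuple; case: (unliftP ord0 j) => [j' ->|->].
  by rewrite eq_sym (negPf (neq_lift _ _)) !tnthS.
by rewrite eqxx.
Qed.

Lemma upd_consS m (x s : R) (t : m.-tuple mR) (i : 'I_m) :
  upd (Defs.cons_tuple (x, t)) (lift ord0 i) s = Defs.cons_tuple (x, upd t i s).
Proof.
apply: eq_from_tnth => j; rewrite tnth_mktuple; case: (unliftP ord0 j) => [j' ->|->].
  by rewrite !tnthS tnth_mktuple (inj_eq lift_inj).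
by rewrite (negPf (neq_lift _ _)).
Qed.

Lemma box_cons m (B x : R) (t : m.-tuple mR) :
  box (fun=> - B) (fun=> B) (Defs.cons_tuple (x, t)) <->
  `|x| <= B /\ box (fun=> - B) (fun=> B) t.
Proof.
split=> [H|[H1 H2] i].
  split; first by have := H ord0; rewrite ler_norml.
  by move=> i; have := H (lift ord0 i); rewrite tnthS.
by case: (unliftP ord0 i) => [j ->|->]; rewrite ?tnthS//= -ler_norml.
Qed.

(** Induction along the product structure of the measure, with Fubini in the order suited to i: if i
    is the first coordinate, it is integrated innermost and the fundamental theorem of calculus
    applies; otherwise the tail is innermost and the induction hypothesis applies. The bounds and
    the compact support supply integrability. *)
Lemma integral_partial0 m (i : 'I_m) (G g : m.-tuple mR -> R) (B M : R) : 0 <= B ->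
  measurable_fun setT g -> (forall t, `|g t| <= M) ->
  (forall t, ~ box (fun=> - B) (fun=> B) t -> G t = 0 /\ g t = 0) ->
  (forall t (s : R), is_derive s 1 (fun s => G (upd t i s)) (g (upd t i s))) ->
  (forall t, continuous (fun s => g (upd t i s))) ->
  (\int[lebesgue_tuple m]_t (g t)%:E = 0)%E.
Proof.
move=> B0; elim: m i G g => [[]//|m IH] i G g mg gM g0 dG cg.
have ig := integrable_box_supported B0 mg gM (fun t tB => (g0 t tB).2).
have mgc : measurable_fun setT (g \o @Defs.cons_tuple R m).
  exact: (measurableT_comp mg (@measurable_cons_tuple R m)).
pose mu := lebesgue_tuple (R := R) m.
have igc : ((@lebesgue_measure R) \x mu)%E.-integrable setT (EFin \o (g \o @Defs.cons_tuple R m)).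
  apply/integrableP; split; first exact/measurable_EFinP.
  move/integrableP: (ig) => [_]; apply: le_lt_trans.
  rewrite /= /lebesgue_step [leRHS](ge0_integral_pushforward (@measurable_cons_tuple R m))//.
  by apply/measurable_EFinP; exact: measurableT_comp.
rewrite /= /lebesgue_step [LHS](integral_pushforward (@measurable_cons_tuple R m))//; last first.
  exact/measurable_EFinP.
rewrite preimage_setT.
case: (unliftP ord0 i) => [j|] ij.
- rewrite -(integral12_prod_meas1 igc) integral0_eq// => x _.
  rewrite /fubini_F /=.
  apply: (IH j (fun t => G (Defs.cons_tuple (x, t))) (fun t => g (Defs.cons_tuple (x, t)))) => //.
  + exact: (measurableT_comp mg (measurable_cons_tuple_l x)).
  + by move=> t tB; apply: g0 => /box_cons[].
  + by move=> t s; have := dG (Defs.cons_tuple (x, t)) s; rewrite ij upd_consS; under eq_fun do rewrite upd_consS.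
  + by move=> t; have := cg (Defs.cons_tuple (x, t)); rewrite ij; under eq_fun do rewrite upd_consS.
- rewrite -(integral21_prod_meas1 igc) integral0_eq// => t _.
  rewrite /fubini_G /=.
  apply: (@integral_derivative_compact (fun s => G (Defs.cons_tuple (s, t))) (fun s => g (Defs.cons_tuple (s, t))) B) => //.
  + by move=> s; have := dG (Defs.cons_tuple (s, t)) s; rewrite ij upd_cons0; under eq_fun do rewrite upd_cons0.
  + by have := cg (Defs.cons_tuple (0, t)); rewrite ij; under eq_fun do rewrite upd_cons0.
  + by move=> s sB; apply: (g0 _ _).1 => /box_cons[]; rewrite leNgt sB.
  + by move=> s sB; apply: (g0 _ _).2 => /box_cons[]; rewrite leNgt sB.
Qed.

End PartialDerivativeIntegral.

Section PartialDerivativeRow.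
Context {R : realType} {n : nat}.
Local Notation mR := (measurableTypeR R).
Local Notation E := 'rV[R]_n.+1.
Local Notation "''e_' i" := (delta_mx 0 i : 'rV[R]_n.+1) (at level 8, i at level 2, format "''e_' i").

Lemma row_upd (t : n.+1.-tuple mR) i s :
  row_of_tuple (upd t i s) = row_of_tuple (upd t i 0) + s *: 'e_i.
Proof.
apply/rowP => j; rewrite !mxE !tnth_mktuple eqxx /= eq_sym.
by case: ifP; rewrite ?mulr1 ?add0r ?mulr0 ?addr0.
Qed.

Lemma not_box_enorm (t : n.+1.-tuple mR) (B : R) :
  ~ box (fun=> - B) (fun=> B) t -> B < enorm (row_of_tuple t).
Proof.
move=> tB; rewrite ltNge; apply/negP => tB'; apply: tB => i; rewrite -ler_norml.
by apply: le_trans tB'; have := coord_le_enorm (row_of_tuple t) i; rewrite mxE.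
Qed.

Lemma enorm_continuous : continuous (fun y : E => enorm y).
Proof.
move=> y; apply: (@continuous_comp _ _ _ (fun y : E => dot y y) Num.sqrt); last first.
  exact: sqrt_continuous.
exact/differentiable_continuous/differentiable_dot.
Qed.

Lemma compact_ball_bounded (F : E -> R) (B : R) : 0 <= B -> continuous F ->
  exists M, forall y, enorm y <= B -> `|F y| <= M.
Proof.
move=> B0 cF; pose K := [set y : E | enorm y <= B].
have cK : compact K.
  apply: bounded_closed_compact.
    exists B; split; first exact: num_real.
    by move=> M BM y yB /=; rewrite (le_trans (norm_le_enorm y))// (le_trans yB)// ltW.
  rewrite (_ : K = (fun y : E => enorm y) @^-1` [set x | x <= B])//.
  by apply: preimage_closed => [y _|]; [exact: enorm_continuous|exact: closed_le].
have [||c _ cmax] := compact_EVT_max (_ : K !=set0) cK (_ : {within K, continuous (fun y => `|F y|)}).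
- by exists 0; rewrite /K/= enorm0.
- by apply: continuous_subspaceT => y; exact: cvg_norm (cF y).
by exists `|F c| => y yB; apply: cmax; rewrite inE.
Qed.

Lemma integral_partial_row0 (Z : E -> R) i (B : R) : 0 <= B ->
  (forall y, differentiable Z y) -> continuous ('D_('e_i) Z) ->
  (forall y, B < enorm y -> Z y = 0) ->
  (lebesgue_tuple n.+1).-integrable setT (fun t => ('D_('e_i) Z (row_of_tuple t))%:E) /\
  (\int[lebesgue_tuple n.+1]_t ('D_('e_i) Z (row_of_tuple t))%:E = 0)%E.
Proof.
move=> B0 dZ cZ Z0.
have DZ0 y : B < enorm y -> 'D_('e_i) Z y = 0.
  move=> yB; rewrite (@near_eq_derive _ _ _ Z (cst 0)) ?derive_cst//.
  have : \forall z \near y, B < enorm z by have := @enorm_continuous y => /cvgr_gt; apply.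
  by apply: filterS => z; exact: Z0.
have [M HM] := compact_ball_bounded B0 cZ.
have mg : measurable_fun setT ('D_('e_i) Z \o @row_of_tuple R n.+1).
  rewrite (_ : setT = [set t : n.+1.-tuple mR | [set: E] (row_of_tuple t)])//.
  exact: (measurable_row_continuous (@openT 'rV[R]_n.+1) (fun y _ => cZ y)).
have gM t : `|('D_('e_i) Z \o @row_of_tuple R n.+1) t| <= `|M|.
  rewrite /=; have [yB|yB] := leP (enorm (row_of_tuple t)) B.
    exact: le_trans (HM _ yB) (ler_norm _).
  by rewrite DZ0 ?normr0.
split.
  by apply: (integrable_box_supported B0 mg gM) => t /not_box_enorm; exact: DZ0.
apply: (@integral_partial0 R _ i (Z \o @row_of_tuple R n.+1) ('D_('e_i) Z \o @row_of_tuple R n.+1) B `|M|) => //.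
- by move=> t /not_box_enorm tB; rewrite /= Z0// DZ0.
- move=> t s /=; rewrite row_upd; under eq_fun do rewrite row_upd.
  exact: is_derive_line.
- move=> t; rewrite (_ : (fun s => _) =
    'D_('e_i) Z \o (fun s : R => row_of_tuple (upd t i 0) + s *: 'e_i)); last first.
    by apply/funext => s /=; rewrite row_upd.
  have cl : continuous (fun s : R => row_of_tuple (upd t i 0) + s *: 'e_i).
    by move=> s; apply: cvgD; [exact: cvg_cst|apply: cvgZr_tmp; exact: cvg_id].
  by move=> s; exact: continuous_comp (cl s) (cZ _).
Qed.

End PartialDerivativeRow.

(** * Radial cutoffs of class C^1 *)

Section Cutoff.
Context {R : realType}.
Implicit Types s t : R.

Lemma continuous_compR (f g : R -> R) :
  continuous f -> continuous g -> continuous (fun s => g (f s)).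
Proof.
move=> cf cg s; apply: (@continuous_comp R R R f g); [exact: cf|exact: cg].
Qed.

Lemma continuous_mulR (f g : R -> R) :
  continuous f -> continuous g -> continuous (fun s => f s * g s).
Proof. by move=> cf cg s; exact: cvgM (cf s) (cg s). Qed.

Definition pospart t : R := (t + `|t|) / 2.

Lemma pospart_ge t : 0 <= t -> pospart t = t.
Proof. by move=> t0; rewrite /pospart ger0_norm//; lra. Qed.

Lemma pospart_le t : t <= 0 -> pospart t = 0.
Proof. by move=> t0; rewrite /pospart ler0_norm//; lra. Qed.

Lemma pospart_ge0 t : 0 <= pospart t.
Proof. by have [t0|/ltW t0] := leP 0 t; [rewrite pospart_ge|rewrite pospart_le]. Qed.

Lemma continuous_pospart : continuous pospart.
Proof. by move=> t; apply: cvgMr_tmp; apply: cvgD; [exact: cvg_id|exact: norm_continuous]. Qed.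

Definition ramp t : R := pospart t ^+ 2.

Lemma is_derive_ramp t : is_derive t 1 ramp (2 * pospart t).
Proof.
have [t0|t0|->] := ltgtP t 0.
- rewrite pospart_le ?ltW// mulr0.
  have H : \forall s \near t, cst 0 s = ramp s.
    near=> s; rewrite /ramp pospart_le ?expr0n//.
    by apply/ltW; near: s; exact: lt_nbhsl.
  exact: near_eq_is_derive H (is_derive_cst _ _ _).
- rewrite pospart_ge ?ltW//.
  have H : \forall s \near t, s ^+ 2 = ramp s.
    near=> s; rewrite /ramp pospart_ge//.
    by apply/ltW; near: s; exact: lt_nbhsr.
  apply: near_eq_is_derive H _.
  apply: (is_derive_eq (is_deriveX 2 (is_derive_id t (1 : R)))).
  by rewrite /= expr1 /GRing.scale/= mulr1.
- rewrite pospart_ge// mulr0.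
  (* At the junction the difference quotient is h for h > 0 and 0 for h < 0. *)
  have : h^-1 *: ((ramp \o shift 0) (h *: (1 : R)) - ramp 0) @[h --> 0^'] --> (0 : R).
    apply/cvgrPdist_le => e e0; near=> h.
    have ramp0 : ramp 0 = 0 by rewrite /ramp pospart_ge// expr0n.
    rewrite ramp0 subr0 sub0r normrN /= addr0 [h%:A]mulr1 /ramp /GRing.scale/=.
    have h0 : h != 0 by near: h; exact: nbhs_dnbhs_neq.
    have he : `|h| <= e by near: h; exact: dnbhs0_le.
    have [hp|hn] := leP 0 h; last first.
      by rewrite (pospart_le (ltW hn)) expr0n mulr0 normr0; exact: ltW.
    by rewrite pospart_ge// expr2 mulKf.
  by move=> H; split; [apply/cvg_ex; exists 0|exact: cvg_lim].
Unshelve. all: by end_near. Qed.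

(** A C^1 transition from 0 on t <= 0 to 1 on t >= 1, obtained by composing two quadratic ramps. A
    single derivative of the cutoff is ever taken, so C^1 suffices. *)
Definition step t : R := ramp (1 - ramp (1 - t)).

Lemma step_le0 t : t <= 0 -> step t = 0.
Proof.
move=> t0; rewrite /step /ramp (@pospart_ge (1 - t)); last by lra.
by rewrite pospart_le ?expr0n//; nra.
Qed.

Lemma step_ge1 t : 1 <= t -> step t = 1.
Proof.
move=> t1; rewrite /step /ramp (@pospart_le (1 - t)); last by lra.
by rewrite expr0n subr0 pospart_ge// expr1n.
Qed.

Lemma step_itv t : 0 <= step t <= 1.
Proof.
rewrite /step /ramp exprn_ge0 ?pospart_ge0//=.
set w := pospart (1 - t) ^+ 2; have w0 : 0 <= w by rewrite sqr_ge0.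
have p0 := pospart_ge0 (1 - w); rewrite expr_le1//.
by have [w1|/ltW w1] := leP 0 (1 - w); [rewrite pospart_ge//; lra|rewrite pospart_le].
Qed.

Definition step' t : R := 2 * pospart (1 - ramp (1 - t)) * (2 * pospart (1 - t)).

Lemma is_derive_step t : is_derive t 1 step (step' t).
Proof.
have d1 : is_derive t 1 (fun s => 1 - s) (-1).
  apply: (is_derive_eq (is_deriveB (is_derive_cst (1 : R) t 1) (is_derive_id t (1 : R)))).
  by rewrite sub0r.
have d2 : is_derive t 1 (fun s => ramp (1 - s)) (- (2 * pospart (1 - t))).
  by apply: is_derive_eq; [exact: (@is_derive1_comp _ ramp (fun s => 1 - s) _ _ _ (is_derive_ramp _) d1)|rewrite mulrN1].
have d3 : is_derive t 1 (fun s => 1 - ramp (1 - s)) (2 * pospart (1 - t)).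
  by apply: (is_derive_eq (is_deriveB (is_derive_cst (1 : R) t 1) d2)); rewrite sub0r opprK.
exact: (@is_derive1_comp _ ramp (fun s => 1 - ramp (1 - s)) _ _ _ (is_derive_ramp _) d3).
Qed.

Lemma continuous_step : continuous step.
Proof.
by move=> t; apply/differentiable_continuous/derivable1_diffP; have [] := is_derive_step t.
Qed.

Lemma continuous_ramp : continuous ramp.
Proof.
by move=> t; apply/differentiable_continuous/derivable1_diffP; have [] := is_derive_ramp t.
Qed.

Lemma continuous_step' : continuous step'.
Proof.
have c1 : continuous (fun t : R => 1 - t) by move=> t; apply: cvgB; [exact: cvg_cst|exact: cvg_id].
move=> t; apply: cvgM; apply: cvgM; try exact: cvg_cst.
- apply: (@continuous_comp _ _ _ (fun t => 1 - ramp (1 - t)) pospart); last exact: continuous_pospart.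
  apply: cvgB; first exact: cvg_cst.
  by apply: (@continuous_comp _ _ _ (fun t => 1 - t) ramp); [exact: c1|exact: continuous_ramp].
- by apply: (@continuous_comp _ _ _ (fun t => 1 - t) pospart); [exact: c1|exact: continuous_pospart].
Qed.

(* C^1 cutoffs, supported in [1/(j+1), 2], that converge pointwise to the
   indicator function of ]0, 1]. *)
Definition cutoff (j : nat) s : R :=
  step (j.+1%:R * s - 1) * step (1 - j.+1%:R * (s - 1)).

Definition cutoff' (j : nat) s : R :=
  step (j.+1%:R * s - 1) * (step' (1 - j.+1%:R * (s - 1)) * - j.+1%:R) +
  step (1 - j.+1%:R * (s - 1)) * (step' (j.+1%:R * s - 1) * j.+1%:R).

Lemma is_derive_cutoff j s : is_derive s 1 (cutoff j) (cutoff' j s).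
Proof.
have d1 : is_derive s 1 (fun s => j.+1%:R * s - 1) (j.+1%:R : R).
  by apply: is_derive_eq; rewrite /GRing.scale/=; ring.
have d2 : is_derive s 1 (fun s => 1 - j.+1%:R * (s - 1)) (- j.+1%:R : R).
  by apply: is_derive_eq; rewrite /GRing.scale/=; ring.
have e1 := @is_derive1_comp _ step (fun s => j.+1%:R * s - 1) _ _ _ (is_derive_step _) d1.
have e2 := @is_derive1_comp _ step (fun s => 1 - j.+1%:R * (s - 1)) _ _ _ (is_derive_step _) d2.
exact: is_deriveM.
Qed.

Lemma continuous_cutoff' j : continuous (cutoff' j).
Proof.
have c1 : continuous (fun s : R => j.+1%:R * s - 1).
  by move=> t; apply: cvgB; [apply: cvgMl_tmp; exact: cvg_id|exact: cvg_cst].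
have c2 : continuous (fun s : R => 1 - j.+1%:R * (s - 1)).
  move=> t; apply: cvgB; first exact: cvg_cst.
  by apply: cvgMl_tmp; apply: cvgB; [exact: cvg_id|exact: cvg_cst].
have k1 : continuous (fun s : R => step (j.+1%:R * s - 1)).
  exact: (continuous_compR c1 continuous_step).
have k2 : continuous (fun s : R => step (1 - j.+1%:R * (s - 1))).
  exact: (continuous_compR c2 continuous_step).
have l1 : continuous (fun s : R => step' (j.+1%:R * s - 1)).
  exact: (continuous_compR c1 continuous_step').
have l2 : continuous (fun s : R => step' (1 - j.+1%:R * (s - 1))).
  exact: (continuous_compR c2 continuous_step').
have m1 := continuous_mulR k1 (continuous_mulR l2 (@cst_continuous R R (- j.+1%:R))).
have m2 := continuous_mulR k2 (continuous_mulR l1 (@cst_continuous R R j.+1%:R)).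
by move=> s; exact: cvgD (m1 s) (m2 s).
Qed.

Lemma cutoff_itv j s : 0 <= cutoff j s <= 1.
Proof.
have /andP[a0 a1] := step_itv (j.+1%:R * s - 1).
have /andP[b0 b1] := step_itv (1 - j.+1%:R * (s - 1)).
by rewrite mulr_ge0//= mulr_ile1.
Qed.

Lemma cutoff_small j s : s <= j.+1%:R^-1 -> cutoff j s = 0.
Proof.
by move=> sj; rewrite /cutoff step_le0 ?mul0r// subr_le0 mulrC -ler_pdivlMr// div1r.
Qed.

Lemma cutoff_large j s : 2 <= s -> cutoff j s = 0.
Proof.
move=> s2; rewrite /cutoff [X in _ * X]step_le0 ?mulr0// subr_le0.
have j1 : 1 <= j.+1%:R :> R by rewrite ler1n.
by nra.
Qed.

Lemma cvg_cutoff s : cutoff j s @[j --> \oo] --> ((0 < s <= 1)%R%:R : R).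
Proof.
have [s0|s0] := leP s 0.
  rewrite (_ : (fun j => _) = fun=> 0) ?ltNge ?s0; first exact: cvg_cst.
  by apply/funext => j; rewrite cutoff_small// (le_trans s0).
have big (e : R) : 0 < e -> \forall j \near \oo, 1 <= j.+1%:R * e.
  move=> e0; near=> j; rewrite -ler_pdivrMr// (le_trans (_ : _ <= j%:R))//.
    by near: j; exact: nbhs_infty_ger.
  by rewrite ler_nat.
have [s1|s1] := leP s 1 => /=.
  apply: cvg_near_cst; near=> j.
  rewrite /cutoff [X in _ * X]step_ge1; last first.
    by rewrite lerDl oppr_ge0 mulr_ge0_le0// subr_le0.
  rewrite mulr1 step_ge1// lerBrDr; have : 1 <= j.+1%:R * (s / 2) by near: j; apply: big; lra.
  by lra.
apply: cvg_near_cst; near=> j.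
rewrite /cutoff [X in _ * X]step_le0 ?mulr0// subr_le0.
by near: j; apply: big; rewrite subr_gt0.
Unshelve. all: by end_near. Qed.

End Cutoff.

(** * Integration by parts on the sphere *)

Section Green.
Context {R : realType} {n : nat}.
Local Notation mR := (measurableTypeR R).
Local Notation E := 'rV[R]_n.+1.
Local Notation "''e_' i" := (delta_mx 0 i : 'rV[R]_n.+1) (at level 8, i at level 2, format "''e_' i").
Implicit Types (p : sphere R n) (y : E).

Section CompDot.
Variables (g g' : R -> R).
Hypotheses (dg : forall s : R, is_derive s 1 g (g' s)) (cg : continuous g').

Lemma differentiable_comp_dot y : differentiable (fun z : E => g (dot z z)) y.
Proof.
apply: (@differentiable_comp1 _ _ g (fun z : E => dot z z)); last exact: differentiable_dot.
by have [] := dg (dot y y).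
Qed.

Lemma derive_comp_dot v y : 'D_v (fun z : E => g (dot z z)) y = g' (dot y y) * (2 * dot y v).
Proof.
rewrite [LHS](@derive_comp1 _ _ g (fun z : E => dot z z)) ?derive_dot; last exact: differentiable_dot.
  by have [_ ->] := dg (dot y y).
by have [] := dg (dot y y).
Qed.

Lemma Ck1_comp_dot : Ck 1 (fun z : E => g (dot z z)).
Proof.
split=> [y _|v]; first exact: differentiable_comp_dot.
apply: (@eq_Ck _ _ 0 _ (fun y => g' (dot y y) * (2 * dot y v))).
  by move=> y _; rewrite derive_comp_dot.
have c1 : Ck 0 (fun y : E => g' (dot y y)).
  move=> y _; apply: (@continuous_comp _ _ _ (fun y : E => dot y y) g'); last exact: cg.
  exact/differentiable_continuous/differentiable_dot.
by apply: (CkM c1); apply: CkZ; exact: Ck_dotl.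
Qed.

Variables (a b : R).
Hypotheses (a0 : 0 < a) (b0 : 0 <= b).
Hypotheses (ga : forall s, s < a -> g s = 0) (gb : forall s, b ^+ 2 < s -> g s = 0).

(* The divergence of the vector field g(|y|^2) psi(y / |y|) grad u, which has
   compact support in R^(n+1) \ {0}; g' drops out since grad u is orthogonal
   to the position vector. *)
Lemma integral_cutoff_green (u psi : sphere R n -> R) :
  sphere_Ck 2 u -> sphere_Ck 1 psi ->
  let Q y := lap (homext u) y * homext psi y +
    \sum_i 'D_('e_i) (homext u) y * 'D_('e_i) (homext psi) y in
  (lebesgue_tuple n.+1).-integrable setT
    (fun t => (g (dot (row_of_tuple t) (row_of_tuple t)) * Q (row_of_tuple t))%:E) /\
  (\int[lebesgue_tuple n.+1]_t
    (g (dot (row_of_tuple t) (row_of_tuple t)) * Q (row_of_tuple t))%:E = 0)%E.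
Proof.
move=> Cu Cp Q; have [du d2u] := Cu; have [dp _] := Cp.
pose Z i y := g (dot y y) * ('D_('e_i) (homext u) y * homext psi y).
have near_small y : dot y y < a -> \forall z \near y, dot z z < a.
  by move=> ya; have := differentiable_continuous (differentiable_dot y) => /cvgr_lt; apply.
have dot00 : dot (0 : E) 0 = 0 by apply/eqP; rewrite dot_eq0.
have Z0 i y : dot y y < a -> Z i y = 0 by move=> ya; rewrite /Z ga// mul0r.
have DZ0 i y : dot y y < a -> 'D_('e_i) (Z i) y = 0.
  move=> ya; rewrite (@near_eq_derive _ _ _ (Z i) (cst 0)) ?derive_cst//.
  by apply: filterS (near_small _ ya) => z; exact: Z0.
have CZ i : Ck 1 (Z i).
  have C2 : Ck 1 (fun y => 'D_('e_i) (homext u) y * homext psi y).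
    exact: (CkM (Ck_derive 'e_i (Cu : Ck 2 (homext u))) (Cp : Ck 1 (homext psi))).
  exact: (CkM Ck1_comp_dot C2).
have dZ i y : differentiable (Z i) y.
  (* The extensions are singular at 0, but [g] vanishes on s < a, so the field is identically 0 near
     the origin. *)
  have [->|y0] := eqVneq y 0; last by have [d _] := CZ i; exact: d.
  apply: (@near_eq_differentiable _ _ _ (cst 0)); last exact: differentiable_cst.
  by apply: filterS (near_small 0 _) => [z za|]; rewrite ?Z0// dot00.
have cZ i : continuous ('D_('e_i) (Z i)).
  move=> y; have [->|y0] := eqVneq y 0; last by have [_ c] := CZ i; exact: c.
  have N : \forall z \near (0 : E), cst 0 z = 'D_('e_i) (Z i) z.
    by apply: filterS (near_small 0 _) => [z za|]; rewrite ?DZ0// dot00.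
  rewrite /continuous_at DZ0 ?dot00//.
  exact: cvg_trans (near_eq_cvg N) (cvg_cst _).
have Zb i y : b < enorm y -> Z i y = 0.
  by move=> yb; rewrite /Z gb ?mul0r// -sqr_enorm ltrXn2r// nnegrE sqrtr_ge0.
have H i := integral_partial_row0 b0 (dZ i) (cZ i) (Zb i).
have divZ t : (g (dot (row_of_tuple t) (row_of_tuple t)) * Q (row_of_tuple t))%:E =
    (\sum_(i < n.+1) ('D_('e_i) (Z i) (row_of_tuple t))%:E)%E.
  rewrite sumEFin; congr (_%:E); set y := row_of_tuple t.
  have [->|y0] := eqVneq y 0.
    by rewrite dot00 ga// mul0r big1// => i _; rewrite DZ0// dot00.
  have e := euler_homext (du y y0).
  transitivity (\sum_i (2 * g' (dot y y) * homext psi y * (y 0 i * 'D_('e_i) (homext u) y)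
     + g (dot y y) * ('D_('e_i) ('D_('e_i) (homext u)) y * homext psi y
       + 'D_('e_i) (homext u) y * 'D_('e_i) (homext psi) y))).
    rewrite big_split/= -!mulr_sumr e mulr0 add0r; congr (_ * _).
    by rewrite /Q /lap mulr_suml big_split.
  apply: eq_bigr => i _.
  have d2 := C2_diff2 'e_i Cu y0.
  have d1 := dp y y0.
  rewrite /Z deriveMR; [|exact: differentiable_comp_dot|exact: differentiableM].
  rewrite derive_comp_dot deriveMR// dot_delta.
  by move: ('D_('e_i) ('D_('e_i) (homext u)) y) ('D_('e_i) (homext u) y) ('D_('e_i) (homext psi) y) => x1 x2 x3; ring.
split.
  by under eq_fun do rewrite divZ; apply: integrable_sum => // i _; exact: (H i).1.
under eq_integral do rewrite divZ.
rewrite integral_sum//; last by move=> i; exact: (H i).1.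
by rewrite big1// => i _; exact: (H i).2.
Qed.

End CompDot.

Lemma integral_sphere0 (F : sphere R n -> R) : sphere_Ck 0 F ->
  (\int[lebesgue_tuple n.+1]_(t in punctured_ball) (homext F (row_of_tuple t))%:E = 0)%E ->
  (\int[sphere_vol R n]_p (F p)%:E = 0)%E.
Proof.
move=> CF; pose Fe p := (F p)%:E.
have mF : measurable_fun setT Fe by apply/measurable_EFinP; exact: measurable_sphere_Ck.
move=> F0; have {F0} : (\int[lebesgue_tuple n.+1]_(t in punctured_ball)
    (Fe \o @radial_tuple R n) t = 0)%E by exact: F0.
rewrite integralE funepos_comp funeneg_comp => F0; rewrite integralE.
have mFp : measurable_fun setT (Fe^\+)%E by exact: measurable_funepos.
have mFn : measurable_fun setT (Fe^\-)%E by exact: measurable_funeneg.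
rewrite (ge0_integral_sphere mFp)// (ge0_integral_sphere mFn)//.
(* For extended reals a - b = 0 forces both to be finite, the difference of two infinities not being
   0; the signed integral can thus be scaled through its positive and negative parts. *)
have key (a b : \bar R) : (a - b = 0 -> n.+1%:R%:E * a - n.+1%:R%:E * b = 0)%E.
  case: a => [a| |]; case: b => [b| |] //=; rewrite -EFinB => -[ab].
  by rewrite -!EFinM -EFinB -mulrBr ab mulr0.
exact: (key _ _ F0).
Qed.

Lemma integral_green (u psi : sphere R n -> R) : sphere_Ck 2 u -> sphere_Ck 1 psi ->
  (\int[sphere_vol R n]_p (laplacian u p * psi p + dot (grad u p) (grad psi p))%:E = 0)%E.
Proof.
move=> Cu Cp; pose F p := laplacian u p * psi p + dot (grad u p) (grad psi p).
have C1u : sphere_Ck 1 u := sphere_CkS Cu.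
have CF : sphere_Ck 0 F.
  apply: (@eq_Ck _ _ _ _ (fun y => homext (laplacian u) y * homext psi y +
     \sum_i homext (fun p => grad u p 0 i) y * homext (fun p => grad psi p 0 i) y)).
    by move=> y y0; rewrite /homext /F /= dotE.
  have CL : Ck 0 (homext (laplacian u)) := sphere_Ck_laplacian Cu.
  have Cp0 : Ck 0 (homext psi) := CkW (Cp : Ck 1 (homext psi)).
  have Gu i : Ck 0 (homext (fun p => grad u p 0 i)) := sphere_Ck_grad i C1u.
  have Gp i : Ck 0 (homext (fun p => grad psi p 0 i)) := sphere_Ck_grad i Cp.
  exact: (CkD (CkM CL Cp0) (Ck_sum (fun i => CkM (Gu i) (Gp i)))).
apply: (integral_sphere0 CF).
pose Q y := lap (homext u) y * homext psi y +
    \sum_i 'D_('e_i) (homext u) y * 'D_('e_i) (homext psi) y.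
have FQ y : y != 0 -> homext F y = dot y y * Q y.
  move=> y0; have := homext_dot_grad C1u Cp y0; have := homext_laplacian Cu y0.
  by rewrite /homext /F /Q /= => -> ->; rewrite mulrDr mulrA.
(* Q has degree -2 and |y|^2 Q is the extension of F. The extra factor s = |y|^2 thus makes the
   integrand a cutoff times the extension of F, whose limit is the integrand of the cone integral
   over the punctured ball. *)
pose g j (s : R) := cutoff j s * s.
pose g' j (s : R) := cutoff j s * 1 + s * cutoff' j s.
have dg j (s : R) : is_derive s 1 (g j) (g' j s).
  exact: (is_deriveM (is_derive_cutoff j s) (is_derive_id s (1 : R))).
have cc j : continuous (cutoff (R := R) j).
  by move=> s; apply/differentiable_continuous/derivable1_diffP; have [] := is_derive_cutoff j s.
have cg j : continuous (g' j).
  have m1 := continuous_mulR (cc j) (@cst_continuous R R 1).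
  have ci : continuous (fun s : R => s) by move=> s; exact: cvg_id.
  have m2 := continuous_mulR ci (@continuous_cutoff' R j).
  by move=> s; exact: cvgD (m1 s) (m2 s).
have ga j (s : R) : s < j.+1%:R^-1 -> g j s = 0.
  by move=> sj; rewrite /g cutoff_small ?mul0r// ltW.
have gb j (s : R) : 2 ^+ 2 < s -> g j s = 0.
  by move=> s2; rewrite /g cutoff_large ?mul0r//; lra.
have a0 j : 0 < j.+1%:R^-1 :> R by rewrite invr_gt0.
have b0 : 0 <= 2 :> R by [].
have H j := integral_cutoff_green (dg j) (@cg j) (a0 j) b0 (@ga j) (@gb j) Cu Cp.
pose f_ j t := (g j (dot (row_of_tuple t) (row_of_tuple t)) * Q (row_of_tuple t))%:E.
have [M M0 HM] := sphere_C0_bounded CF.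
have fE j t : f_ j t = (cutoff j (dot (row_of_tuple t) (row_of_tuple t)) * homext F (row_of_tuple t))%:E.
  rewrite /f_ /g; set y := row_of_tuple t; congr (_%:E).
  have [->|y0] := eqVneq y 0; last by rewrite FQ// mulrA.
  have -> : dot (0 : E) 0 = 0 by apply/eqP; rewrite dot_eq0.
  by rewrite cutoff_small ?invr_ge0// !mul0r.
pose B : set (n.+1.-tuple mR) := box (fun=> - 2) (fun=> 2).
have mB : measurable B by exact: measurable_box.
(* Dominating function: outside the cube of half-side 2 one has |y| > 2 and every cutoff vanishes;
   inside, the extension of F is bounded by the bound of F on the sphere. *)
have iM : (lebesgue_tuple n.+1).-integrable setT (EFin \o (fun t => M * \1_B t)).
  apply: (@integrable_box_supported _ _ _ 2 M) => //.
  - by apply: measurable_funM => //; exact: measurable_indic.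
  - by move=> t; rewrite normrM ger0_norm// indicE ler_piMr//; case: (t \in B); rewrite ?normr1 ?normr0.
  - by move=> t tB; rewrite indicE memNset// mulr0.
have cvf t : f_ ^~ t @ \oo --> ((fun t => (homext F (row_of_tuple t))%:E) \_ punctured_ball) t.
  set y := row_of_tuple t.
  have lim : (cutoff j (dot y y) * homext F y)%:E @[j --> \oo] --> ((0 < dot y y <= 1)%R%:R * homext F y)%:E.
    by apply: cvg_EFin; [exact: nearW|apply: cvgMr_tmp; exact: cvg_cutoff].
  rewrite (_ : _ t = ((0 < dot y y <= 1)%R%:R * homext F y)%:E).
    by under eq_fun do rewrite fE.
  rewrite patchE; have -> : (t \in punctured_ball) = (0 < dot y y <= 1).
    apply/idP/idP => [|H1]; rewrite ?inE /punctured_ball/= -/y.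
      by move=> /andP[h1 h2]; rewrite -sqr_enorm exprn_gt0// expr_le1// sqrtr_ge0.
    move: H1 => /andP[h1 h2]; rewrite sqrtr_gt0 h1/=.
    by rewrite -sqrtr1 ler_wsqrtr.
  by case: ifP; rewrite ?mul1r ?mul0r.
have mf j : measurable_fun setT (f_ j) by exact: measurable_int (H j).1.
have mlim : measurable_fun setT ((fun t => (homext F (row_of_tuple t))%:E) \_ (@punctured_ball R n)).
  by apply: (emeasurable_fun_cvg f_) => // t _; exact: cvf.
have dom j t : (`|f_ j t| <= (M * \1_B t)%:E)%E.
  rewrite fE lee_fin; set y := row_of_tuple t.
  have [tB|tB] := boolP (t \in B).
    rewrite indicE tB mulr1 normrM -[M]mul1r ler_pM//; last exact: HM.
    by have /andP[h1 h2] := cutoff_itv j (dot y y); rewrite ger0_norm.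
  rewrite cutoff_large ?mul0r ?normr0 ?mulr_ge0//.
  have /not_box_enorm : ~ B t by move=> /mem_set; apply/negP.
  rewrite -/y => y2; rewrite -sqr_enorm; have := sqrtr_ge0 (dot y y); rewrite -/(enorm y); nra.
have [_ _] := @dominated_convergence _ _ _ (lebesgue_tuple n.+1) setT measurableT f_
  ((fun t => (homext F (row_of_tuple t))%:E) \_ punctured_ball) (fun t => (M * \1_B t)%:E)
  mf mlim (aeW _ (fun t _ => cvf t)) iM (aeW _ (fun t j _ => dom j t)).
rewrite [X in X @ _ --> _](_ : _ = cst 0%E); last by apply/funext => j; exact: (H j).2.
rewrite -integral_mkcond => H0.
exact: (cvg_unique _ H0 (cvg_cst _)).
Qed.

End Green.

(** * Sharpness of the exponents *)

Section Sharpness.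
Context {R : realType} {n : nat}.
Local Notation E := 'rV[R]_n.+1.
Implicit Types (p : sphere R n).

(** Integrability is implicit: a zero integral means that the integrals of the positive and negative
    parts are finite and equal. *)
Lemma integral_opp0 d (T : measurableType d) (mu : {measure set T -> \bar R})
    (f : T -> \bar R) :
  (\int[mu]_x f x = 0 -> \int[mu]_x (- f x) = 0)%E.
Proof.
rewrite integralE => f0; rewrite integralE funeposN funenegN; move: f0.
case: (\int[mu]_x _)%E => [a| |]; case: (\int[mu]_x _)%E => [b| |] //=.
by rewrite -!EFinB => -[ab]; congr (_%:E); lra.
Qed.

Lemma H1_smooth (u : sphere R n -> R) : smooth u -> H1 u (grad u).
Proof.
move=> su; split.
- exact: measurable_sphere_Ck (su 0%N).
- by move=> i; apply: measurable_sphere_Ck; exact: sphere_Ck_grad (su 1%N).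
exists (fun=> u); split => //.
- under eq_fun do under eq_integral do rewrite subrr normr0 expr0n.
  by rewrite integral0; exact: cvg_cst.
- under eq_fun do under eq_integral do rewrite subrr enorm0 expr0n.
  by rewrite integral0; exact: cvg_cst.
Qed.

(** With the eigenvalue equation for h_k the weak formulation is the negative of Green's formula for
    h_k and the test function. *)
Lemma H1_solution_h k : (0 < n)%N ->
  H1_solution (fun=> 0) (fun=> k%:R * (k%:R + n%:R - 1)) (@h R n k).
Proof.
move=> n0; exists (grad (h k)); first exact/H1_smooth/smooth_h.
move=> psi spsi.
have := integral_opp0 (integral_green (smooth_h k 2%N) (spsi 1%N)).
apply: etrans; apply: eq_integral => p _.
rewrite -EFinN; congr (_%:E).
rewrite (laplacianE p (smooth_h k 2%N)) lap_homext_h//.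
rewrite [dot 0 _](_ : _ = 0); first by ring.
by rewrite /dot big1// => i _; rewrite big1// => j _; rewrite mxE mul0r.
Qed.

(** Taking f = 0 lets the mass estimates for [phi] serve for h_k. *)
Lemma phi0 k : phi (fun=> 0) k = @h R n k.
Proof. by apply/funext => p; rewrite /phi mulr0 expR0 mul1r. Qed.

Lemma vanishing_order_h k : (2 <= n)%N -> (1 <= k)%N ->
  vanishing_order (@h R n k) north = (k%:R : R)%:E.
Proof. by move=> n2 k1; rewrite -phi0 vanishing_order_phi//; exact: Ck_cst. Qed.

(** A function that is 0 almost everywhere has no mass on any ball, against the lower bound c
    r^(2k+n) > 0. *)
Lemma nontrivial_h k : (2 <= n)%N -> nontrivial (@h R n k).
Proof.
move=> n2 h0.
have C0 : sphere_Ck 0 (fun _ : sphere R n => 0 : R) by exact: Ck_cst.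
have [c c0] := @phi_ball_mass_ge R n (fun=> 0) k 0 n2 C0 (fun q => ler_of_eq (normr0 _)).
rewrite phi0 => Hc.
have /filter_ex[r [[r0 r1] Hr]] : \forall r \near (0 : R)^'+,
    (0 < r /\ r <= 1) /\ ((c * r ^+ (k.*2 + n))%:E <= ball_mass (@h R n k) r)%E.
  apply: filterI => //; apply: filterI; first exact: nbhs_right_gt.
  exact: nbhs_right_le.
move: Hr; rewrite /ball_mass (@ge0_ae_eq_integral _ _ _ _ _ _ (cst 0%E))//.
- by rewrite integral0 lee_fin leNgt mulr_gt0// exprn_gt0.
- apply: measurable_geodesic_ball; rewrite ltW//= (le_trans r1)//.
  by rewrite (le_trans _ (pi_ge2 R))// ler1n.
- apply/measurable_EFinP; apply: measurable_funTS; apply: measurable_funX.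
  apply: measurableT_comp => //; apply: measurable_sphere_Ck; exact: smooth_h.
- by apply: filterS h0 => x hx _; rewrite hx normr0 expr0n.
Qed.

Lemma C1norm_cst (c : R) : 0 <= c -> C1norm (fun _ : sphere R n => c) = c%:E.
Proof.
move=> c0; rewrite /C1norm.
have -> : supnorm (fun _ : sphere R n => c) = c%:E.
  apply/eqP; rewrite eq_le supnorm_le => [|p]; last by rewrite ger0_norm.
  by have := le_supnorm (fun _ : sphere R n => c) north; rewrite ger0_norm.
rewrite [X in (_ + X)%E](_ : _ = 0%E) ?adde0//.
apply/eqP; rewrite eq_le supnorm_ge0 andbT; apply: supnorm_le => p.
rewrite (_ : grad _ p = 0) ?enorm0 ?normr0//.
apply/rowP => i; rewrite gradE mxE.
by rewrite (_ : homext _ = cst c)// derive_cst.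
Qed.

Lemma C1norm_field0 : C1norm_field (fun _ : sphere R n => 0 : E) = 0%E.
Proof.
have z (f : sphere R n -> R) : (forall p, f p = 0) -> supnorm f = 0%E.
  move=> f0; apply/eqP; rewrite eq_le supnorm_ge0 andbT.
  by apply: supnorm_le => p; rewrite f0 normr0.
rewrite /C1norm_field !z ?adde0// => p; last by rewrite enorm0.
rewrite /cov (_ : 'J _ _ = 0) ?mul0mx ?enorm0//.
have dc : differentiable (homext (fun _ : sphere R n => 0 : E)) (p : E).
  exact: differentiable_cst.
apply/matrixP => i j; apply: etrans (jacobianE i j dc) _; rewrite [RHS]mxE.
rewrite (_ : (fun z => _) = cst 0) ?derive_cst//.
by apply/funext => y; rewrite /homext /= mxE.
Qed.

(** Any integer k >= 1 with k >= |K|^(1 / (1 - g)) satisfies |K| <= k^(1 - g), and multiplying by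
    k^g gives the claim. *)
Lemma powR_nat_unbounded (g K : R) : g < 1 ->
  exists k : nat, (1 <= k)%N /\ K * k%:R `^ g <= k%:R.
Proof.
move=> g1; have g1' : 0 < 1 - g by rewrite subr_gt0.
have [N NK] : exists N : nat, `|K| `^ (1 - g)^-1 <= N%:R.
  exists (Num.bound (`|K| `^ (1 - g)^-1)); apply/ltW.
  by apply: le_lt_trans (archi_boundP _); rewrite ?powR_ge0.
exists N.+1; split=> //.
have k0 : 0 < N.+1%:R :> R by [].
have HK : `|K| <= N.+1%:R `^ (1 - g).
  have -> : `|K| = (`|K| `^ (1 - g)^-1) `^ (1 - g).
    by rewrite -powRrM mulVf ?powRr1// gt_eqF.
  apply: ge0_ler_powR; rewrite ?nnegrE ?powR_ge0 ?ltW//.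
  by apply: le_lt_trans NK _; rewrite ltr_nat.
apply: (@le_trans _ _ (N.+1%:R `^ (1 - g) * N.+1%:R `^ g)).
  by rewrite ler_wpM2r ?powR_ge0// (le_trans (ler_norm _)).
by rewrite -powRD ?subrK ?powRr1 ?(ltW k0)// gt_eqF ?implybT.
Qed.

(* Tested on V = 0 and the spherical harmonic h_k, an eigenfunction for
   W = k (k + n - 1); the V-term 0 `^ alpha is then at most 1 for every alpha. *)
Lemma not_uniform_bound (alpha beta : R) : (2 <= n)%N -> beta < 2^-1 ->
  ~ uniform_bound n alpha beta.
Proof.
move=> n2 b2 [C C0 HC]; have n0 : (0 < n)%N by exact: ltnW.
(* Replacing a negative exponent by 0 only enlarges l^beta, as l >= 1, and makes k^(2b) at least 1,
   while 2b < 1 persists. *)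
pose b := Num.max beta 0.
have b0 : 0 <= b by rewrite le_max lexx orbT.
have bb : beta <= b by rewrite le_max lexx.
have b12 : b < 2^-1 by rewrite /b gt_max b2 /= invr_gt0 ltr0n.
have n1R : 1 <= n%:R :> R by rewrite ler1n.
(* The factor 2 + n absorbs the whole bracket: 1 and 0^alpha are each at most k^(2b), and l^beta is
   at most n k^(2b). *)
have [k [k1 Hk]] := @powR_nat_unbounded (2 * b) (C * (2 + n%:R)) ltac:(lra).
have k1R : 1 <= k%:R :> R by rewrite ler1n.
pose l : R := k%:R * (k%:R + n%:R - 1).
have l1 : 1 <= l by rewrite /l; nra.
have l2 : l <= n%:R * k%:R ^+ 2.
  suff : 0 <= (n%:R - 1) * (k%:R * (k%:R - 1)) :> R by rewrite /l; lra.
  by rewrite !mulr_ge0 ?subr_ge0.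
have t0 : tangent (fun _ : sphere R n => 0 : E).
  by move=> p; rewrite /dot big1// => i _; rewrite big1// => j _; rewrite mxE mul0r.
have := HC (fun=> l) (fun=> 0) (Ck_cst 1 l) t0 (Ck_cst 1 (0 : E)) (@h R n k)
  (H1_solution_h k n0) (nontrivial_h (k := k) n2) north.
rewrite vanishing_order_h// C1norm_cst ?C1norm_field0; last by lra.
rewrite !poweR_EFin -!EFinD -EFinM lte_fin ltNge; apply/negP; rewrite negbK.
apply: le_trans Hk; rewrite -mulrA ler_wpM2l ?(ltW C0)//.
have a1 : 0 `^ alpha <= 1 :> R.
  by have [->|an] := eqVneq alpha 0; rewrite ?powRr0// powR0.
have kb : 1 <= k%:R `^ (2 * b).
  by rewrite -[leLHS](powRr0 (k%:R : R)) ler_powR// mulr_ge0.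
have lb : l `^ beta <= n%:R * k%:R `^ (2 * b).
  apply: le_trans (ler_powR l1 bb) _.
  apply: (@le_trans _ _ ((n%:R * k%:R ^+ 2) `^ b)).
    by rewrite ge0_ler_powR// nnegrE; [lra|rewrite mulr_ge0// exprn_ge0].
  rewrite powRM ?exprn_ge0// -powR_mulrn// -powRrM ler_wpM2r ?powR_ge0//.
  by rewrite ler1_powR//; lra.
by rewrite mulrDl; lra.
Qed.

End Sharpness.

Theorem mainTheorem5 (R : realType) (n : nat) (hn : (2 <= n)%N)
    (f : sphere R n -> R) (fsmooth : smooth f)
    (fnonconst : exists x y : sphere R n, f x <> f y) :
  [/\ (forall k : nat, (1 <= k)%N ->
        vanishing_order (phi f k) north = (k%:R : R)%:E),
      (forall k : nat, (1 <= k)%N -> forall x : sphere R n,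
        laplacian (phi f k) x =
          dot (Vk f k x) (grad (phi f k) x) + Wk f k x * phi f k x),
      (exists2 C : R, 0 < C & forall k : nat, (1 <= k)%N ->
        ((C^-1 * k%:R)%:E <= C1norm_field (Vk f k) <= (C * k%:R)%:E)%E /\
        ((C^-1 * k%:R ^+ 2)%:E <= C1norm (Wk f k) <= (C * k%:R ^+ 2)%:E)%E) &
      (forall alpha beta : R, alpha < 1 -> beta < 2^-1 ->
        ~ uniform_bound n alpha beta)].
Proof.
have n0 : (0 < n)%N by exact: ltnW.
split.
- by move=> k k1; exact: vanishing_order_phi (fsmooth 0%N).
- by move=> k _ x; exact: laplacian_phi (fsmooth 2%N).
- exact: potential_norm_bounds (fsmooth 3%N) fnonconst.
- by move=> alpha beta _ b2; exact: not_uniform_bound.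
Qed.
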